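(* Timeline Partial Dominating Set restricted to instances with $\ell=0$ is fixed-parameter tractable with respect to $n=|V|$.
   Context: A temporal graph $\mathcal{G}=(G_1,\dots,G_T)$ is a finite sequence of simple undirected graphs (snapshots) on a common finite vertex set $V$, $n=|V|$. A temporal vertex is a pair $(v,i)$. An activity interval is a triple $(v,a,b)$ with $v\in V$, $1\le a\le b\le T$; its length is $b-a$. A $k$-activity $\ell$-timeline is a set of activity intervals with at most $k$ intervals per vertex, each of length at most $\ell$. A vertex $v$ is active at time $i$ if some $(v,a,b)$ in the timeline has $a\le i\le b$; the timeline dominates $(v,i)$ if $v\in N_{G_i}[u]$ for some $u$ active at time $i$. Timeline Partial Dominating Set: given $\mathcal{G}$ and integers $k\ge1,\ell\ge0,t\ge0$, decide whether some $k$-activity $\ell$-timeline dominates at least $t$ temporal vertices. *)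

(* Defs.v *)
From HB Require Import structures.
From mathcomp Require Import all_boot.

Set Implicit Arguments.
Unset Strict Implicit.
Unset Printing Implicit Defensive.

(* Model of computation: N. D. Jones's imperative language WHILE over binary
   trees (Computability and Complexity from a Programming Perspective, MIT
   Press 1997), charging one unit for each elementary operation.  Trees can be
   stored as shared heap cells, so a run of time t is simulated by a Turing
   machine in time polynomial in t plus the input size, and conversely; the
   class FPT is therefore the same as for Turing machines or RAMs. *)

Inductive tree : Type := Leaf | Node of tree & tree.

Fixpoint tsize (d : tree) : nat :=
  if d is Node d1 d2 then (tsize d1 + tsize d2).+1 else 1.

Inductive expr : Type :=
| EVar of nat
| ENil
| ECons of expr & expr
| EHd of expr
| ETl of expr.

Inductive cmd : Type :=
| Skip
| Assign of nat & expr
| Seq of cmd & cmd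
| If of expr & cmd & cmd
| While of expr & cmd.

Definition store := nat -> tree.

Definition update (s : store) (x : nat) (d : tree) : store :=
  fun y => if y == x then d else s y.

Definition thd (d : tree) : tree := if d is Node d1 _ then d1 else Leaf.
Definition ttl (d : tree) : tree := if d is Node _ d2 then d2 else Leaf.

Fixpoint eval (s : store) (e : expr) : tree :=
  match e with
  | EVar x => s x
  | ENil => Leaf
  | ECons e1 e2 => Node (eval s e1) (eval s e2)
  | EHd e1 => thd (eval s e1)
  | ETl e1 => ttl (eval s e1)
  end.

Fixpoint etime (e : expr) : nat :=
  match e with
  | EVar _ | ENil => 1
  | ECons e1 e2 => (etime e1 + etime e2).+1
  | EHd e1 | ETl e1 => (etime e1).+1
  end.

(* The truth value of a tree: Leaf is false, every Node is true. *)
Definition truthy (d : tree) : bool := if d is Node _ _ then true else false.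

(* exec c s t s' : started in store s, the command c terminates in store s'
   after exactly t time units. *)
Inductive exec : cmd -> store -> nat -> store -> Prop :=
| exec_skip s : exec Skip s 1 s
| exec_assign s x e :
    exec (Assign x e) s (etime e).+1 (update s x (eval s e))
| exec_seq c1 c2 s s1 s2 t1 t2 :
    exec c1 s t1 s1 -> exec c2 s1 t2 s2 -> exec (Seq c1 c2) s (t1 + t2) s2
| exec_if_true e c1 c2 s s1 t :
    truthy (eval s e) -> exec c1 s t s1 ->
    exec (If e c1 c2) s (etime e + t).+1 s1
| exec_if_false e c1 c2 s s1 t :
    ~~ truthy (eval s e) -> exec c2 s t s1 ->
    exec (If e c1 c2) s (etime e + t).+1 s1
| exec_while_true e c s s1 s2 t1 t2 :
    truthy (eval s e) -> exec c s t1 s1 -> exec (While e c) s1 t2 s2 ->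
    exec (While e c) s (etime e + t1 + t2).+1 s2
| exec_while_false e c s :
    ~~ truthy (eval s e) -> exec (While e c) s (etime e).+1 s.

(* Variable 0 is both the input and the output variable. *)
Definition runs (p : cmd) (input : tree) (t : nat) (output : tree) : Prop :=
  exists2 s : store, exec p (update (fun=> Leaf) 0 input) t s & s 0 = output.

Definition unary (n : nat) : tree := iter n (Node Leaf) Leaf.

Definition computable (f : nat -> nat) : Prop :=
  exists p : cmd, forall n, exists t, runs p (unary n) t (unary (f n)).

Record param_problem := ParamProblem {
  instance : Type;
  encode : instance -> tree;
  param : instance -> nat;
  yes : instance -> Prop
}.

Definition restrict (Q : param_problem) (C : instance Q -> Prop) :
    param_problem :=
  @ParamProblem {x : instance Q | C x}
    (fun x => encode (sval x)) (fun x => param (sval x))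
    (fun x => yes (sval x)).

(* One program decides every instance x in time f(param x) * |x|^c. *)
Definition fpt (Q : param_problem) : Prop :=
  exists (p : cmd) (f : nat -> nat) (c : nat), computable f /\
    forall x : instance Q, exists (t : nat) (d : tree),
      [/\ runs p (encode x) t d,
          t <= f (param x) * tsize (encode x) ^ c
        & truthy d <-> yes x].

Record sgraph (V : finType) := SGraph {
  adj :> rel V;
  adj_sym : symmetric adj;
  adj_irrefl : irreflexive adj
}.

Definition closed_nbh (V : finType) (G : sgraph V) (u : V) : {set V} :=
  [set v | (v == u) || G u v].

(* Times are numbered 0, ..., T-1 instead of 1, ..., T. *)
Definition temporal_graph (V : finType) (T : nat) := 'I_T -> sgraph V.

Record activity_interval (V : finType) (T : nat) := ActivityInterval {
  itriple :> V * 'I_T * 'I_T;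
  itripleP : itriple.1.2 <= itriple.2
}.
HB.instance Definition _ (V : finType) (T : nat) :=
  [isSub for @itriple V T].
HB.instance Definition _ (V : finType) (T : nat) :=
  [Finite of activity_interval V T by <:].

Definition ivertex (V : finType) (T : nat) (I : activity_interval V T) : V := I.1.1.
Definition istart (V : finType) (T : nat) (I : activity_interval V T) : 'I_T := I.1.2.
Definition iend (V : finType) (T : nat) (I : activity_interval V T) : 'I_T := I.2.
Definition ilength (V : finType) (T : nat) (I : activity_interval V T) : nat :=
  iend I - istart I.

Definition is_timeline (V : finType) (T : nat) (k l : nat)
    (L : {set activity_interval V T}) : Prop :=
  (forall v : V, #|[set I in L | ivertex I == v]| <= k) /\
  (forall I : activity_interval V T, I \in L -> ilength I <= l).

Definition active (V : finType) (T : nat) (L : {set activity_interval V T})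
    (v : V) (i : 'I_T) : bool :=
  [exists I in L, (ivertex I == v) && (istart I <= i <= iend I)].

Definition dominated (V : finType) (T : nat) (G : temporal_graph V T)
    (L : {set activity_interval V T}) : {set V * 'I_T} :=
  [set p | [exists u, active L u p.2 && (p.1 \in closed_nbh (G p.2) u)]].

Record tpds_instance := TpdsInstance {
  tpds_V : finType;
  tpds_T : nat;
  tpds_G : temporal_graph tpds_V tpds_T;
  tpds_k : nat;
  tpds_l : nat;
  tpds_t : nat;
  tpds_k_ge1 : 1 <= tpds_k
}.

Definition tpds_yes (x : tpds_instance) : Prop :=
  exists L : {set activity_interval (tpds_V x) (tpds_T x)},
    is_timeline (tpds_k x) (tpds_l x) L /\
    tpds_t x <= #|dominated (@tpds_G x) L|.

(* Encoding of instances: the vertex set as n in unary, each snapshot as its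
   n x n adjacency matrix, and k, l, t in binary. *)

Definition enc_bool (b : bool) : tree := if b then Node Leaf Leaf else Leaf.

Definition enc_seq (s : seq tree) : tree := foldr Node Leaf s.

(* Least significant bit first; up_log 2 n.+1 is the bit length of n. *)
Definition enc_nat (n : nat) : tree :=
  enc_seq (mkseq (fun i => enc_bool (odd (n %/ 2 ^ i))) (up_log 2 n.+1)).

Definition enc_sgraph (V : finType) (G : sgraph V) : tree :=
  enc_seq [seq enc_seq [seq enc_bool (G u v) | v <- enum V] | u <- enum V].

Definition enc_temporal_graph (V : finType) (T : nat)
    (G : temporal_graph V T) : tree :=
  Node (unary #|V|) (enc_seq [seq enc_sgraph (G i) | i <- enum 'I_T]).

Definition enc_tpds (x : tpds_instance) : tree :=
  Node (enc_temporal_graph (@tpds_G x))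
    (Node (enc_nat (tpds_k x)) (Node (enc_nat (tpds_l x)) (enc_nat (tpds_t x)))).

Definition timeline_partial_dominating_set : param_problem :=
  @ParamProblem tpds_instance enc_tpds (fun x => #|tpds_V x|) tpds_yes.

(* Main.v *)
Require Import Defs.
From mathcomp Require Import all_boot all_order ssralg ssrnum ssrint zify.

Set Implicit Arguments.
Unset Strict Implicit.
Unset Printing Implicit Defensive.
Import Order.TTheory GRing.Theory Num.Theory.

(* With l = 0 a timeline is a choice of a set A_i of active vertices for every
   time i, each vertex being chosen at most k times.  The choice is improved by
   local search.  If x is feasible and y is feasible and better, the vectors
   y_i - x_i, completed by slack vectors, sum to zero; adding the n coordinates
   one at a time and using the pigeonhole principle on prefix sums, they are
   partitioned into zero-sum groups of size at most gbound n.  Exchanging one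
   group keeps x feasible, and some group increases the profit.  Hence a
   non-optimal choice has a better one that differs from it in at most gbound n
   times.  A best choice at such a distance is found by dynamic programming
   over the times: the states are the number of changes that are left, the
   profit and the usage vector, and as the latter two stay close to those of
   the current choice, their number is bounded in terms of n.  The profit is at
   most n T, which bounds the number of rounds.

   The algorithm is written in a small functional language over trees that is
   compiled to WHILE programs; the running time of a term is polynomial in the
   largest length of a list that it traverses. *)

(** * A functional language compiled to WHILE *)

(** The obstacle is the number of usage vectors: a single dynamic program over the times that
    records them would have about T^n states, with the parameter in the exponent. Local search keeps
    all vectors within a radius of the current ones that depends on n only. Slack is needed because
    y may use a vertex more or less often than x, so the differences alone need not cancel. A group
    that takes part of the slack of a vertex moves its usage part of the way from its value in x to
    its value in y, and both are at most k. The profit is not among the balanced coordinates: the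
    gains of the groups add up to the gain of y over x, so one of them is positive. Two requirements
    shape the program. As k and t are given in binary, they are cut at a value that no profit or
    usage reaches before they are turned into unary. And the function of n in the time bound must be
    computable, so it gets a program of its own. *)

Inductive tm : Type :=
| TVar of nat
| TNil
| TCons of tm & tm
| THd of tm
| TTl of tm
| TIte of tm & tm & tm
| TLet of tm & tm
| TFold of tm & tm & tm
| TCall of tm & tm & tm & tm & tm.

Fixpoint tfoldl (F : tree -> tree -> tree) (acc l : tree) : tree :=
  if l is Node h r then tfoldl F (F acc h) r else acc.

(** Variables are de Bruijn indices; a fold binds the element as 0 and the accumulator as 1. The
    body of a [TCall] sees only its four arguments, so a subroutine is analysed once for all
    environments that it is called from. Folds are the only iteration, hence every term
    terminates. *)
Fixpoint tsem (env : seq tree) (t : tm) : tree :=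
  match t with
  | TVar i => nth Leaf env i
  | TNil => Leaf
  | TCons a b => Node (tsem env a) (tsem env b)
  | THd a => thd (tsem env a)
  | TTl a => ttl (tsem env a)
  | TIte c a b => if truthy (tsem env c) then tsem env a else tsem env b
  | TLet a b => tsem (tsem env a :: env) b
  | TFold l i b =>
      tfoldl (fun acc h => tsem [:: h, acc & env] b) (tsem env i) (tsem env l)
  | TCall f a b c d =>
      tsem [:: tsem env a; tsem env b; tsem env c; tsem env d] f
  end.

Fixpoint tlen (l : tree) : nat := if l is Node _ r then (tlen r).+1 else 0.

Fixpoint sfold (F : tree -> tree -> tree) (S : tree -> tree -> Prop)
    (acc l : tree) : Prop :=
  if l is Node h r then S acc h /\ sfold F S (F acc h) r else True.

(* Every list traversed during the evaluation has length at most M. *)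
Fixpoint safe (M : nat) (env : seq tree) (t : tm) : Prop :=
  match t with
  | TVar _ | TNil => True
  | TCons a b => safe M env a /\ safe M env b
  | THd a | TTl a => safe M env a
  | TIte c a b => safe M env c /\
      (if truthy (tsem env c) then safe M env a else safe M env b)
  | TLet a b => safe M env a /\ safe M (tsem env a :: env) b
  | TFold l i b => [/\ safe M env l, safe M env i, tlen (tsem env l) <= M &
      sfold (fun acc h => tsem [:: h, acc & env] b)
            (fun acc h => safe M [:: h, acc & env] b) (tsem env i) (tsem env l)]
  | TCall f a b c d =>
      [/\ safe M env a, safe M env b, safe M env c, safe M env d &
        safe M [:: tsem env a; tsem env b; tsem env c; tsem env d] f]
  end.

(* The variables of the term live in the registers rho; the result is written
   to register d, and the registers from d on serve as a stack. *)
Fixpoint compile (rho : seq nat) (d : nat) (t : tm) : cmd :=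
  match t with
  | TVar i => Assign d (if i < size rho then EVar (nth 0 rho i) else ENil)
  | TNil => Assign d ENil
  | TCons a b => Seq (compile rho d a) (Seq (compile rho d.+1 b)
                  (Assign d (ECons (EVar d) (EVar d.+1))))
  | THd a => Seq (compile rho d a) (Assign d (EHd (EVar d)))
  | TTl a => Seq (compile rho d a) (Assign d (ETl (EVar d)))
  | TIte c a b => Seq (compile rho d c)
                  (If (EVar d) (compile rho d a) (compile rho d b))
  | TLet a b => Seq (compile rho d a) (Seq (compile (d :: rho) d.+1 b)
                  (Assign d (EVar d.+1)))
  | TFold l i b =>
      Seq (compile rho d l) (Seq (compile rho d.+1 i)
        (Seq (While (EVar d)
               (Seq (Assign d.+2 (EHd (EVar d)))
               (Seq (compile [:: d.+2, d.+1 & rho] d.+3 b)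
               (Seq (Assign d.+1 (EVar d.+3)) (Assign d (ETl (EVar d)))))))
             (Assign d (EVar d.+1))))
  | TCall f a b c e =>
      Seq (compile rho d a) (Seq (compile rho d.+1 b)
      (Seq (compile rho d.+2 c) (Seq (compile rho d.+3 e)
      (Seq (compile [:: d; d.+1; d.+2; d.+3] d.+4 f) (Assign d (EVar d.+4))))))
  end.

(** The exponent in the time bound [M ^ deg t]. The bounds of subterms are multiplied instead of
    added, which is generous enough as each of them is at least [M]; the added units are factors [M]
    that absorb constants and, for a fold, pay for its at most [M] rounds. *)
Fixpoint deg (t : tm) : nat :=
  match t with
  | TVar _ | TNil => 1
  | TCons a b | TLet a b => (deg a + deg b).+1
  | THd a | TTl a => (deg a).+1
  | TIte c a b => (deg c + deg a + deg b).+1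
  | TFold l i b => (deg l + deg i + deg b).+3
  | TCall f a b c d => (deg f + deg a + deg b + deg c + deg d).+1
  end.

Lemma updateE s x d : update s x d x = d.
Proof. by rewrite /update eqxx. Qed.

Lemma updateN s x d y : y != x -> update s x d y = s y.
Proof. by rewrite /update => /negbTE ->. Qed.

Lemma map_agree (s s' : store) (rho : seq nat) d :
  all (ltn^~ d) rho -> (forall y, y < d -> s' y = s y) ->
  map s' rho = map s rho.
Proof. by move=> /allP h e; apply/eq_in_map => y /h /e. Qed.

Lemma deg_ge M t : 8 <= M -> M <= M ^ deg t.
Proof.
move=> hM; rewrite -{1}(expn1 M) leq_exp2l; last lia.
by case: t => *.
Qed.

Lemma pow_cost M a b c : 8 <= M -> M <= a -> M <= b -> c <= 8 ->
  a + b + c <= M * (a * b).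
Proof.
move=> hM ha hb hc.
have h1 : 8 * a <= a * b by nia.
have h2 : 8 * b <= a * b by nia.
have h3 : 8 * (a * b) <= M * (a * b) by rewrite leq_mul2r hM orbT.
lia.
Qed.

(** The stack discipline rests on the clause that no register below [d] changes: the variables in
    [rho] and earlier intermediate results survive the evaluation of later subterms. [safe] bounds
    the number of rounds of every loop, and thereby the time. *)
Lemma compile_correct M t rho d s : 8 <= M -> all (ltn^~ d) rho ->
  safe M (map s rho) t ->
  exists s' tau, [/\ exec (compile rho d t) s tau s',
    s' d = tsem (map s rho) t, forall y, y < d -> s' y = s y
    & tau <= M ^ deg t].
Proof.
move=> hM; elim: t rho d s => [i||a IHa b IHb|a IHa|a IHa|c IHc a IHa b IHb|
  a IHa b IHb|l IHl i IHi b IHb|f IHf a IHa b IHb c IHc e IHe] rho d s hr /=.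
- move=> _; eexists _, _; split; first exact: exec_assign.
  + rewrite updateE; case: ltnP => h /=; first by rewrite (nth_map 0).
    by rewrite nth_default // size_map.
  + by move=> y hy; rewrite updateN //; lia.
  + by rewrite expn1; case: ifP => _ /=; lia.
- move=> _; eexists _, _; split; first exact: exec_assign.
  + by rewrite updateE.
  + by move=> y hy; rewrite updateN //; lia.
  + by rewrite expn1 /=; lia.
- case=> sa sb.
  have [s1 [t1 [e1 v1 p1 b1]]] := IHa rho d s hr sa.
  have hr1 : all (ltn^~ d.+1) rho by apply: sub_all hr => y /=; lia.
  have m1 := map_agree hr p1.
  rewrite -m1 in sb; have [s2 [t2 [e2 v2 p2 b2]]] := IHb rho d.+1 s1 hr1 sb.
  eexists _, _; split.
  + by apply: (exec_seq e1); apply: (exec_seq e2); apply: exec_assign.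
  + by rewrite updateE /= v2 m1 p2 // v1.
  + by move=> y hy; rewrite updateN; [rewrite p2 ?p1 //; lia|lia].
  + rewrite expnS expnD /=.
    have := pow_cost hM (deg_ge a hM) (deg_ge b hM) (leqnn 8); lia.
- move=> sa; have [s1 [t1 [e1 v1 p1 b1]]] := IHa rho d s hr sa.
  eexists _, _; split.
  + by apply: (exec_seq e1); apply: exec_assign.
  + by rewrite updateE /= v1.
  + by move=> y hy; rewrite updateN; [rewrite p1 //; lia|lia].
  + rewrite expnS /=; have := deg_ge a hM; nia.
- move=> sa; have [s1 [t1 [e1 v1 p1 b1]]] := IHa rho d s hr sa.
  eexists _, _; split.
  + by apply: (exec_seq e1); apply: exec_assign.
  + by rewrite updateE /= v1.
  + by move=> y hy; rewrite updateN; [rewrite p1 //; lia|lia].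
  + rewrite expnS /=; have := deg_ge a hM; nia.
- case=> sc sab; have [s1 [t1 [e1 v1 p1 b1]]] := IHc rho d s hr sc.
  have m1 := map_agree hr p1.
  have ha := deg_ge a hM; have hb := deg_ge b hM; have hc := deg_ge c hM.
  have hpow x : x <= M ^ deg a + M ^ deg b ->
      t1 + (1 + x).+1 <= M ^ (deg c + deg a + deg b).+1.
    rewrite expnS !expnD; move: b1 ha hb hc.
    move: (M ^ deg c) (M ^ deg a) (M ^ deg b) => C A B *.
    have h1 : C + A + 8 <= M * (C * A) by apply: pow_cost.
    have : M * (C * A) + B <= M * (C * A * B).
      by rewrite !mulnA; move: h1; rewrite !mulnA; move: (M * C * A) => X *;
          nia.
    lia.
  case: ifP sab => tc sab; rewrite -m1 in sab.
  + have [s2 [t2 [e2 v2 p2 b2]]] := IHa rho d s1 hr sab.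
    eexists _, _; split.
    * by apply: (exec_seq e1); apply: exec_if_true e2; rewrite /= v1.
    * by rewrite v2 m1.
    * by move=> y hy; rewrite p2 ?p1.
    * by apply: hpow; lia.
  + have [s2 [t2 [e2 v2 p2 b2]]] := IHb rho d s1 hr sab.
    eexists _, _; split.
    * by apply: (exec_seq e1); apply: exec_if_false e2; rewrite /= v1 tc.
    * by rewrite v2 m1.
    * by move=> y hy; rewrite p2 ?p1.
    * by apply: hpow; lia.
- case=> sa sb.
  have [s1 [t1 [e1 v1 p1 b1]]] := IHa rho d s hr sa.
  have m1 := map_agree hr p1.
  have hr1 : all (ltn^~ d.+1) (d :: rho).
    by rewrite /= ltnSn; apply: sub_all hr => y /=; lia.
  have m1' : map s1 (d :: rho) = tsem (map s rho) a :: map s rho.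
    by rewrite /= v1 m1.
  rewrite -m1' in sb; have [s2 [t2 [e2 v2 p2 b2]]] := IHb _ d.+1 s1 hr1 sb.
  eexists _, _; split.
  + by apply: (exec_seq e1); apply: (exec_seq e2); apply: exec_assign.
  + by rewrite updateE /= v2 m1'.
  + by move=> y hy; rewrite updateN; [rewrite p2 ?p1 //; lia|lia].
  + rewrite expnS expnD /=.
    have := pow_cost hM (deg_ge a hM) (deg_ge b hM) (leqnn 8); lia.
- case=> sl si hlen sbody.
  have [s1 [t1 [e1 v1 p1 b1]]] := IHl rho d s hr sl.
  have hr1 : all (ltn^~ d.+1) rho by apply: sub_all hr => y /=; lia.
  have m1 := map_agree hr p1.
  rewrite -m1 in si; have [s2 [t2 [e2 v2 p2 b2]]] := IHi rho d.+1 s1 hr1 si.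
  have vd : s2 d = tsem (map s rho) l by rewrite p2.
  have vd1 : s2 d.+1 = tsem (map s rho) i by rewrite v2 m1.
  have ps2 y : y < d -> s2 y = s y by move=> hy; rewrite p2 ?p1 //; lia.
  set body := Seq (Assign d.+2 _) _.
  (* In the loop, [d] holds the rest of the list and [d.+1] the accumulator. Besides the body a
     round costs 10 units: 2 for the test and 3 + 2 + 3 for the assignments. The failing last test
     costs 2. *)
  have loop L A s0 : s0 d = L -> s0 d.+1 = A ->
      (forall y, y < d -> s0 y = s y) ->
      sfold (fun acc h => tsem [:: h, acc & map s rho] b)
            (fun acc h => safe M [:: h, acc & map s rho] b) A L ->
      exists s' tau, [/\ exec (While (EVar d) body) s0 tau s',
        s' d.+1 = tfoldl (fun acc h => tsem [:: h, acc & map s rho] b) A L,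
        forall y, y < d -> s' y = s y
        & tau <= 2 + tlen L * (M ^ deg b + 10)].
    elim: L A s0 => [|h _ r IHr] A s0 hL hA ps0 /=.
      move=> _; exists s0, 2; split=> //.
      by apply: exec_while_false; rewrite /= hL.
    case=> sb srest.
    pose s3 := update s0 d.+2 h.
    have ps3 y : y < d.+2 -> s3 y = s0 y by move=> hy; rewrite /s3 updateN //;
        lia.
    have hr3 : all (ltn^~ d.+3) [:: d.+2, d.+1 & rho].
      by rewrite /= !ltnS leqnn leqnSn; apply: sub_all hr => y /=; lia.
    have m3 : map s3 [:: d.+2, d.+1 & rho] = [:: h, A & map s rho].
      rewrite /= {1}/s3 updateE ps3 // hA; congr [:: _, _ & _].
      by apply: (map_agree hr) => y hy; rewrite ps3 ?ps0 //; lia.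
    rewrite -m3 in sb; have [s4 [t4 [e4 v4 p4 b4]]] := IHb _ d.+3 s3 hr3 sb.
    rewrite m3 in v4.
    pose s5 := update s4 d.+1 (s4 d.+3).
    pose s6 := update s5 d (ttl (s5 d)).
    have s5d : s5 d = Node h r.
      by rewrite /s5 updateN ?p4 ?ps3 ?hL //; lia.
    have [s7 [t7 [e7 v7 p7 b7]]] : exists s' tau,
        [/\ exec (While (EVar d) body) s6 tau s',
        s' d.+1 = tfoldl (fun acc h => tsem [:: h, acc & map s rho] b)
          (tsem [:: h, A & map s rho] b) r,
        forall y, y < d -> s' y = s y
        & tau <= 2 + tlen r * (M ^ deg b + 10)].
      apply: (IHr _ s6) => //.
      - by rewrite /s6 updateE s5d.
      - by rewrite /s6 updateN ?/s5 ?updateE ?v4 //; lia.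
      - move=> y hy; rewrite /s6 updateN; last lia.
        rewrite /s5 updateN; last lia.
        by rewrite p4 ?ps3 ?ps0 //; lia.
    exists s7; eexists; split; [|exact: v7|exact: p7|].
      apply: exec_while_true (e7); first by rewrite /= hL.
      apply: exec_seq; first exact: exec_assign.
      rewrite /= hL /=; apply: (exec_seq e4).
      by apply: exec_seq; apply: exec_assign.
    rewrite /= mulSn; lia.
  have [s3 [t3 [e3 v3 p3 b3]]] := loop _ _ _ vd vd1 ps2 sbody.
  eexists _, _; split.
  + by apply: (exec_seq e1); apply: (exec_seq e2); apply: (exec_seq e3);
       apply: exec_assign.
  + by rewrite updateE /= v3.
  + by move=> y hy; rewrite updateN; [rewrite p3 //; lia|lia].
  + have hl := deg_ge l hM; have hi := deg_ge i hM; have hb := deg_ge b hM.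
    have {}b3 : t3 <= 2 + M * (M ^ deg b + 10).
      by apply: leq_trans b3 _; rewrite leq_add2l leq_mul2r hlen orbT.
    rewrite !expnS !expnD /=; move: b1 b2 b3 hl hi hb.
    move: (M ^ deg l) (M ^ deg i) (M ^ deg b) => A B C *.
    have h1 : A + B + 8 <= M * (A * B) by apply: pow_cost.
    have h2 : M * (C + 10) <= M * (M * C) by nia.
    have h3 : M * (A * B) + M * (M * C) <= M * (M * (M * (A * B * C))).
      have k1 : A * B <= A * B * C by apply: leq_pmulr; lia.
      have k2 : C <= A * B * C by apply: leq_pmull; rewrite muln_gt0; lia.
      have k3 : M * (A * B) <= M * (M * (A * B * C)).
        by rewrite leq_mul2l (leq_trans k1) ?orbT ?leq_pmull //; lia.
      have k4 : M * (M * C) <= M * (M * (A * B * C)).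
        by rewrite !leq_mul2l k2 !orbT.
      move: (M * (M * (A * B * C))) k3 k4 => X k3 k4; nia.
    lia.
- case=> sa sb sc se sf.
  have [s1 [t1 [e1 v1 p1 b1]]] := IHa rho d s hr sa.
  have hr1 : all (ltn^~ d.+1) rho by apply: sub_all hr => y /=; lia.
  have m1 := map_agree hr p1.
  rewrite -m1 in sb; have [s2 [t2 [e2 v2 p2 b2]]] := IHb rho d.+1 s1 hr1 sb.
  have hr2 : all (ltn^~ d.+2) rho by apply: sub_all hr => y /=; lia.
  have m2 := map_agree hr1 p2; rewrite m1 in m2.
  rewrite -m2 in sc; have [s3 [t3 [e3 v3 p3 b3]]] := IHc rho d.+2 s2 hr2 sc.
  have hr3 : all (ltn^~ d.+3) rho by apply: sub_all hr => y /=; lia.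
  have m3 := map_agree hr2 p3; rewrite m2 in m3.
  rewrite -m3 in se; have [s4 [t4 [e4 v4 p4 b4]]] := IHe rho d.+3 s3 hr3 se.
  have hr4 : all (ltn^~ d.+4) [:: d; d.+1; d.+2; d.+3].
    by rewrite /=; apply/and5P; split; lia.
  have m4 : map s4 [:: d; d.+1; d.+2; d.+3] =
     [:: tsem (map s rho) a; tsem (map s rho) b; tsem (map s rho) c;
         tsem (map s rho) e].
    rewrite /=; congr [:: _; _; _; _].
    + by rewrite p4 ?p3 ?p2 ?v1 //; lia.
    + by rewrite p4 ?p3 ?v2 ?m1 //; lia.
    + by rewrite p4 ?v3 ?m2 //; lia.
    + by rewrite v4 m3.
  rewrite -m4 in sf; have [s5 [t5 [e5 v5 p5 b5]]] := IHf _ d.+4 s4 hr4 sf.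
  eexists _, _; split.
  + by apply: (exec_seq e1); apply: (exec_seq e2); apply: (exec_seq e3);
       apply: (exec_seq e4); apply: (exec_seq e5); apply: exec_assign.
  + by rewrite updateE /= v5 m4.
  + move=> y hy; rewrite updateN; last lia.
    by rewrite p5 ?p4 ?p3 ?p2 ?p1 //; lia.
  + have := deg_ge a hM; have := deg_ge b hM; have := deg_ge c hM.
    have := deg_ge e hM; have := deg_ge f hM.
    rewrite expnS !expnD /=; move: b1 b2 b3 b4 b5.
    move: (M ^ deg a) (M ^ deg b) (M ^ deg c) (M ^ deg e) (M ^ deg f) =>
        A B C E F b1 b2 b3 b4 b5 hF hE hC hB hA.
    have h1 : A + B + 8 <= M * (A * B) by apply: pow_cost.
    have h0 x y : M <= x -> M <= y -> x + y <= x * y /\ M <= x * y by nia.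
    have [k1 g1] := h0 _ _ hF hA.
    have [k2 g2] := h0 _ _ g1 hB.
    have [k3 g3] := h0 _ _ g2 hC.
    have [k4 g4] := h0 _ _ g3 hE.
    have : 8 * (F * A * B * C * E) <= M * (F * A * B * C * E).
      by rewrite leq_mul2r hM orbT.
    lia.
Qed.

(** * Zero-sum partitions and improving swaps *)

(** A group balanced in [m] coordinates has at most its size, [gbound m], as weight in the next
    coordinate; by pigeonhole, zero-sum blocks then need at most [2 * gbound m + 1] such groups. *)
Fixpoint gbound (m : nat) : nat :=
  if m is m'.+1 then gbound m' * (2 * gbound m').+1 else 1.

Lemma gbound_gt0 m : 0 < gbound m.
Proof. by elim: m => //= m IH; rewrite muln_gt0 IH. Qed.

Lemma leq_gbound m m' : m <= m' -> gbound m <= gbound m'.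
Proof.
elim: m' => [|m' IH]; first by rewrite leqn0 => /eqP ->.
rewrite leq_eqVlt => /orP[/eqP -> //|/IH h]; apply: leq_trans h _.
by rewrite /= leq_pmulr.
Qed.

Local Open Scope ring_scope.

(* The int instances of these bigop lemmas leave sums that lia can read. *)
Lemma sumZ_cons (I : Type) (w : I -> int) x L :
  \sum_(i <- x :: L) w i = w x + \sum_(i <- L) w i.
Proof. exact: big_cons. Qed.

Lemma sumZ_cat (I : Type) (w : I -> int) L L' :
  \sum_(i <- L ++ L') w i = \sum_(i <- L) w i + \sum_(i <- L') w i.
Proof. exact: big_cat. Qed.

Lemma sumZN (I : Type) (w : I -> int) L :
  \sum_(i <- L) - w i = - \sum_(i <- L) w i.
Proof. exact: sumrN. Qed.

Lemma sum_gt0_exists (I : eqType) (w : I -> int) (L : seq I) :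
  0 < \sum_(i <- L) w i -> exists2 i, i \in L & 0 < w i.
Proof.
move=> h; apply/hasP/negPn/negP => /hasPn hn.
suff : \sum_(i <- L) w i <= 0 by lia.
rewrite big_seq; apply: sumr_le0 => i /hn; lia.
Qed.

Lemma sum_ge0_exists (I : eqType) (w : I -> int) (L : seq I) :
  L != [::] -> 0 <= \sum_(i <- L) w i -> exists2 i, i \in L & 0 <= w i.
Proof.
move=> L0 h; apply/hasP/negPn/negP => /hasPn hn.
case: L L0 h hn => // x L _; rewrite sumZ_cons => h hn.
have h1 : w x < 0 by have := hn x (mem_head _ _); lia.
suff : \sum_(i <- L) w i <= 0 by lia.
rewrite big_seq; apply: sumr_le0 => i iL.
by have := hn i; rewrite inE iL orbT => /(_ isT); lia.
Qed.

(** A one-dimensional Steinitz rearrangement: append a negative element when the prefix sum [s] is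
    positive and a nonnegative one otherwise. One exists because the remaining elements sum to
    [- s]. *)
Lemma perm_bounded_prefix_sums (I : eqType) (w : I -> int) (B : nat)
    (L : seq I) (s : int) :
  {in L, forall i, `|w i| <= B%:Z} -> `|s| <= B%:Z ->
  s + \sum_(i <- L) w i = 0 ->
  exists2 L', perm_eq L' L &
    forall j, `|s + \sum_(i <- take j L') w i| <= B%:Z.
Proof.
have [N leN] := ubnP (size L); elim: N L s leN => // N IH L s.
case: (L =P [::]) => [-> _ _ hs _|/eqP L0 leN hw hs h0].
  by exists [::] => // j; rewrite big_nil addr0.
have [x xL hx] : exists2 x, x \in L & `|s + w x| <= B%:Z.
  case: (ltP 0 s) => hs0.
    have [x xL hx] : exists2 x, x \in L & 0 < - w x.
      by apply: sum_gt0_exists; rewrite sumZN; lia.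
    by exists x => //; have := hw x xL; lia.
  have [|x xL hx] := @sum_ge0_exists _ w L L0; first by lia.
  by exists x => //; have := hw x xL; lia.
have pL := perm_to_rem xL.
have [|i|||L' pL' hL'] := IH (rem x L) (s + w x).
- by move: L0 leN; rewrite size_rem // -size_eq0; lia.
- by move/mem_rem/hw.
- by [].
- by move: h0; rewrite (perm_big _ pL) /= sumZ_cons addrA.
exists (x :: L'); first by rewrite perm_sym (permPl pL) perm_cons perm_sym.
case=> [|j]; first by rewrite big_nil addr0.
by rewrite /= sumZ_cons addrA.
Qed.

(** The [2 * B + 2] prefix sums of the rearranged list up to length [2 * B + 1] take at most
    [2 * B + 1] values, so two agree and the elements between them sum to zero. *)
Lemma short_zero_sum_sublist (I : eqType) (w : I -> int) (B : nat)
    (L : seq I) :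
  {in L, forall i, `|w i| <= B%:Z} -> \sum_(i <- L) w i = 0 -> L != [::] ->
  exists S R, [/\ perm_eq (S ++ R) L, S != [::], (size S <= (2 * B).+1)%N &
    \sum_(i <- S) w i = 0].
Proof.
move=> hw h0 L0; case: (leqP (size L) (2 * B).+1) => hsz.
  by exists L, [::]; rewrite cats0.
have [||L' pL hL] := @perm_bounded_prefix_sums _ w B L 0 hw.
- by rewrite normr0; lia.
- by rewrite add0r.
(* The shift by [B] turns prefix sums into naturals below [2 * B + 1]. *)
pose P j := absz (\sum_(i <- take j L') w i + B%:Z).
have Pl j : (P j < (2 * B).+1)%N by have := hL j; rewrite add0r /P; lia.
have : ~~ uniq (mkseq P (2 * B).+2).
  apply/negP => u; suff /(uniq_leq_size u) : {subset mkseq P (2 * B).+2 <=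
    iota 0 (2 * B).+1} by rewrite size_mkseq size_iota; lia.
  by move=> _ /mapP[j _ ->]; rewrite mem_iota add0n /= Pl.
case/(uniqPn 0) => i [j [ij]]; rewrite size_mkseq => hj.
rewrite !nth_mkseq //; last by lia.
move=> eP; have {eP} eqs : \sum_(x <- take i L') w x = \sum_(x <- take j L') w
    x.
  by move: eP (hL i) (hL j); rewrite /P !add0r; lia.
have tij : take j L' = take i L' ++ drop i (take j L').
  by rewrite -[LHS](cat_take_drop i) take_takel // ltnW.
exists (drop i (take j L')), (take i L' ++ drop j L'); split.
- by rewrite -(permPr pL) -[X in perm_eq _ X](cat_take_drop j) {2}tij -catA
    perm_catCA.
- rewrite -size_eq0 size_drop size_takel ?(perm_size pL); lia.
- rewrite size_drop size_takel ?(perm_size pL); lia.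
- by rewrite {1}tij sumZ_cat in eqs; lia.
Qed.

Lemma zero_sum_partition1 (I : eqType) (w : I -> int) (B : nat) (L : seq I) :
  {in L, forall i, `|w i| <= B%:Z} -> \sum_(i <- L) w i = 0 ->
  exists2 gs : seq (seq I), perm_eq (flatten gs) L &
    {in gs, forall S, (size S <= (2 * B).+1)%N /\ \sum_(i <- S) w i = 0}.
Proof.
have [N leN] := ubnP (size L); elim: N L leN => // N IH L leN hw h0.
case: (L =P [::]) => [->|/eqP L0]; first by exists [::].
have [S [R [pL S0 hS hS0]]] := short_zero_sum_sublist hw h0 L0.
have [||| gs pgs hgs] := IH R.
- by move: leN (perm_size pL) S0; rewrite size_cat -size_eq0; lia.
- by move=> i iR; apply: hw; rewrite -(perm_mem pL) mem_cat iR orbT.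
- by move: h0; rewrite -(perm_big _ pL) sumZ_cat hS0 add0r.
exists (S :: gs); first by rewrite /= -(permPr pL) perm_cat2l.
by move=> S'; rewrite inE => /orP[/eqP -> //|/hgs].
Qed.

(** Induction on the number of coordinates: the groups for [m] coordinates become the elements that
    are grouped with respect to coordinate [m], and unions of groups stay balanced in the earlier
    ones. *)
Lemma zero_sum_partition (I : eqType) (m : nat) (w : nat -> I -> int)
    (L : seq I) :
  (forall j, (j < m)%N -> {in L, forall i, `|w j i| <= 1}) ->
  (forall j, (j < m)%N -> \sum_(i <- L) w j i = 0) ->
  exists2 gs : seq (seq I), perm_eq (flatten gs) L &
    {in gs, forall S, (size S <= gbound m)%N /\
      forall j, (j < m)%N -> \sum_(i <- S) w j i = 0}.
Proof.
elim: m => [|m IH] hw h0.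
  exists [seq [:: i] | i <- L]; first by rewrite flatten_seq1.
  by move=> _ /mapP[i _ ->].
have [j jm|j jm|gs pgs hgs] := IH.
- exact: hw (ltnW jm).
- exact: h0 (ltnW jm).
(* Every element weighs at most 1 in absolute value, so a group weighs at most its size. *)
have hb : {in gs, forall S, `|\sum_(i <- S) w m i| <= (gbound m)%:Z}.
  move=> S Sg; have [hS _] := hgs S Sg.
  apply: le_trans (_ : (size S)%:Z <= _); last by lia.
  have : {subset S <= L}.
    by move=> i iS; rewrite -(perm_mem pgs); apply/flattenP; exists S.
  elim: S {Sg hS} => [|i S IHS] hSL; first by rewrite big_nil normr0.
  rewrite sumZ_cons; have h1 : `|w m i| <= 1 by apply: hw => //;
      apply/hSL/mem_head.
  have := IHS (fun x xS => hSL x (@mem_behead _ (i :: S) x xS)).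
  by move=> h2; apply: le_trans (ler_normD _ _) _;
      apply: le_trans (lerD h1 h2) _.
have [|ggs pggs hggs] := zero_sum_partition1 hb.
  by rewrite -big_flatten (perm_big _ pgs); apply: h0.
have sub G : G \in ggs -> {subset G <= gs}.
  by move=> Gg S SG; rewrite -(perm_mem pggs); apply/flattenP; exists G.
exists (map flatten ggs).
  rewrite -(permPr pgs); suff -> : flatten (map flatten ggs) =
    flatten (flatten ggs) by apply: perm_flatten.
  by elim: (ggs) => //= G gs' IHg; rewrite flatten_cat IHg.
move=> _ /mapP[G Gg ->]; have [sG zG] := hggs G Gg; split.
  apply: (@leq_trans (size G * gbound m)).
    rewrite size_flatten; have := sub G Gg.
    elim: (G) => //= S G' IHG hG; rewrite mulSn leq_add //.
      by have [] := hgs S (hG S (mem_head _ _)).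
    by apply: IHG => x xG; apply: hG; rewrite inE xG orbT.
  by rewrite /= mulnC leq_mul2l sG orbT.
move=> j; rewrite big_flatten ltnS leq_eqVlt => /orP[/eqP -> //|jm].
rewrite big_seq big1 // => S SG.
by have [_ ->] := hgs S (sub G Gg S SG).
Qed.

Lemma count_mem_flatten (I : eqType) (a : I) (S : seq I) (gs : seq (seq I)) :
  S \in gs -> (count_mem a S <= count_mem a (flatten gs))%N.
Proof.
elim: gs => //= G gs IH; rewrite inE count_cat => /orP[/eqP ->|/IH]; lia.
Qed.

Definition lefts (A B : Type) : seq (A + B) -> seq A :=
  pmap (fun it => if it is inl i then Some i else None).

Lemma count_mem_lefts (A B : eqType) (S : seq (A + B)) (i : A) :
  count_mem i (lefts S) = count_mem (inl i) S.
Proof. by elim: S => //= -[i'|j] S /= ->. Qed.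

Lemma size_lefts (A B : Type) (S : seq (A + B)) : (size (lefts S) <= size S)%N.
Proof. by elim: S => //= -[i'|j] S /=; lia. Qed.

Lemma sumZ_nat (I : Type) (f : I -> nat) (L : seq I) :
  (\sum_(i <- L) f i)%N%:Z = \sum_(i <- L) (f i)%:Z.
Proof. exact: (big_morph Posz PoszD). Qed.

Lemma sum_swap (x y : nat -> nat) (L S : seq nat) :
  uniq L -> uniq S -> {subset S <= L} ->
  (\sum_(i <- L) (if i \in S then y i else x i))%N%:Z =
  (\sum_(i <- L) x i)%N%:Z + \sum_(i <- S) ((y i)%:Z - (x i)%:Z).
Proof.
move=> uL uS sub; rewrite !sumZ_nat.
have -> : \sum_(i <- S) ((y i)%:Z - (x i)%:Z) =
          \sum_(i <- L | i \in S) ((y i)%:Z - (x i)%:Z).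
  rewrite -[RHS]big_filter; apply: perm_big; apply: uniq_perm => //.
    exact: filter_uniq.
  by move=> i; rewrite mem_filter; case: (boolP (i \in S)) => //= /sub ->.
rewrite [X in _ = _ + X]big_mkcond -big_split /=; apply: eq_bigr => i _.
by case: ifP; lia.
Qed.

(* The usage of a vertex may change, by D say; |D| slack items of weight
   -sgz D make all coordinates of the difference sum to zero.  The part of a
   group that uses only some slack items moves the usage towards that of y. *)
Lemma improving_swap (T n k : nat) (x y : nat -> nat -> nat) :
  (forall i j, (0 < j <= n)%N -> (x i j <= 1)%N /\ (y i j <= 1)%N) ->
  (forall j, (0 < j <= n)%N -> (\sum_(i <- iota 0 T) x i j <= k)%N /\
                               (\sum_(i <- iota 0 T) y i j <= k)%N) ->
  (\sum_(i <- iota 0 T) x i 0 < \sum_(i <- iota 0 T) y i 0)%N ->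
  exists S : seq nat, [/\ (size S <= gbound n)%N,
    forall j, (0 < j <= n)%N ->
      (\sum_(i <- iota 0 T) (if i \in S then y i j else x i j) <= k)%N &
    (\sum_(i <- iota 0 T) x i 0 <
     \sum_(i <- iota 0 T) (if i \in S then y i 0 else x i 0))%N].
Proof.
move=> h01 hk hlt.
pose d j i : int := (y i j)%:Z - (x i j)%:Z.
pose D j : int := \sum_(i <- iota 0 T) d j i.
have DE j : D j = (\sum_(i <- iota 0 T) y i j)%N%:Z -
                  (\sum_(i <- iota 0 T) x i j)%N%:Z.
  by rewrite !sumZ_nat -sumZN -big_split.
(* Coordinate 0 is the profit; only the usages, at [j.+1], are balanced. *)
pose w j (it : nat + nat) : int := match it with
  | inl i => d j.+1 i
  | inr j' => if j == j' then - sgz (D j.+1) else 0 end.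
pose slack s := flatten [seq nseq (absz (D j.+1)) (inr j : nat + nat) | j <- s].
pose L : seq (nat + nat) := map inl (iota 0 T) ++ slack (iota 0 n).
have sumE j S : \sum_(it <- S) w j it =
    \sum_(i <- lefts S) d j.+1 i -
    (count_mem (inr j : nat + nat) S)%:Z * sgz (D j.+1).
  elim: S => [|it S IH]; first by rewrite !big_nil /= mul0r.
  rewrite sumZ_cons IH; case: it => [i|j'] /=;
      first by rewrite sumZ_cons add0n addrA.
  have -> : (inr j' == inr j :> nat + nat) = (j == j') by rewrite eq_sym.
  case: (j =P j') => [->|_] /=; last by rewrite add0n add0r.
  by rewrite add1n intS mulrDl mul1r opprD addrCA.
have lslack s : lefts (slack s) = [::].
  elim: s => //= j s IH; rewrite /lefts pmap_cat.
  by rewrite -/(lefts (slack s)) IH cats0; elim: absz.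
have leftsL : lefts L = iota 0 T.
  rewrite /lefts pmap_cat -/(lefts (slack _)) lslack cats0.
  by elim: iota => //= i s ->.
have countl (i : nat) : count_mem (inl i : nat + nat) L = (i \in iota 0 T).
  by rewrite -count_mem_lefts leftsL count_uniq_mem ?iota_uniq.
have cslack j s : uniq s -> count_mem (inr j : nat + nat) (slack s) =
    (if j \in s then absz (D j.+1) else 0)%N.
  elim: s => //= j' s IH /andP[js us]; rewrite count_cat count_nseq IH //=.
  have -> : (inr j' == inr j :> nat + nat) = (j == j') by rewrite eq_sym.
  rewrite in_cons; case: (j =P j') => [->|_] /=; last by rewrite mul0n.
  by rewrite (negbTE js) mul1n addn0.
have countr j : (j < n)%N -> count_mem (inr j : nat + nat) L = absz (D j.+1).
  move=> jn; rewrite count_cat cslack ?iota_uniq // mem_iota /= add0n jn.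
  by rewrite (_ : count _ _ = 0%N) //; elim: iota.
have [|j jn|gs pgs hgs] := @zero_sum_partition _ n w L.
- move=> j jn; case=> [i|j'] _ /=.
    by have := h01 i j.+1; rewrite /d jn => /(_ isT); lia.
  by case: ifP => _; lia.
- by rewrite sumE leftsL countr // -/(D j.+1); lia.
(* Slack items carry no profit, so the gains of the groups add up to [D 0], which is positive. *)
have [S Sgs hpos] : exists2 S, S \in gs & 0 < \sum_(i <- lefts S) d 0 i.
  apply: sum_gt0_exists.
  have <- : \sum_(it <- flatten gs) (if it is inl i then d 0 i else 0 : int) =
      \sum_(S <- gs) \sum_(i <- lefts S) d 0 i.
    rewrite big_flatten; apply: eq_bigr => S _; rewrite /=.
    elim: S => [|[i|j] S IH]; rewrite ?big_nil // sumZ_cons IH /= ?add0r //.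
    by rewrite sumZ_cons.
  rewrite (perm_big _ pgs) /=.
  have -> : \sum_(it <- L) (if it is inl i then d 0 i else 0 : int) =
      \sum_(i <- lefts L) d 0 i.
    elim: (L) => [|[i|j] S IH]; rewrite ?big_nil // sumZ_cons IH /= ?add0r //.
    by rewrite sumZ_cons.
  by rewrite leftsL -/(D 0%N) DE subr_gt0 ltz_nat.
have cS a : (count_mem a S <= count_mem a L)%N.
  by rewrite -(permP pgs); apply: count_mem_flatten.
have subS : {subset lefts S <= iota 0 T}.
  move=> i; rewrite -[i \in lefts S]has_pred1 has_count count_mem_lefts => h.
  by have := leq_trans h (cS _); rewrite countl; case: (_ \in _).
(* Every time occurs once in [L], hence at most once in a group. *)
have uS : uniq (lefts S).
  apply: count_mem_uniq => i; apply/eqP; rewrite eqn_leq.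
  have -> : (count_mem i (lefts S) <= (i \in lefts S))%N.
    case: (boolP (i \in lefts S)) => hi; last by rewrite leqn0;
        apply/eqP/count_memPn.
    rewrite count_mem_lefts; apply: leq_trans (cS _) _.
    by rewrite countl leq_b1.
  by case: (boolP (i \in lefts S)) => //; rewrite -has_pred1 has_count.
have [szS zS] := hgs S Sgs.
exists (lefts S); split.
- exact: leq_trans (size_lefts S) szS.
- move=> [//|j] jn; have := hk j.+1 jn; have := zS j jn.
  rewrite sumE => z [kx ky].
  have := @sum_swap (x^~ j.+1) (y^~ j.+1) (iota 0 T) (lefts S) (iota_uniq _ _)
      uS subS.
  rewrite -/(d j.+1).
  have := DE j.+1; have := cS (inr j); rewrite countr //.
  move: z; rewrite /d; move: (\sum_(i <- lefts S) _) => s.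
  move: (count_mem _ S) (D j.+1) (\sum_(i <- _) _)%N (\sum_(i <- _) _)%N
      (\sum_(i <- _) _)%N kx ky => c E Sz Sx Sy kx ky.
  (* With [c] slack items in the group the usage changes by [c * sgz E], where [c] is at most the
     absolute value of [E]. The new usage lies between [Sx] and [Sy], both at most [k]. *)
  case: (ltgtP E 0) => [h|h|->]; rewrite ?(ltr0_sgz h) ?(gtr0_sgz h) ?sgz0; lia.
- have := @sum_swap (x^~ 0%N) (y^~ 0%N) (iota 0 T) (lefts S) (iota_uniq _ _) uS
    subS.
  by rewrite /= -ltz_nat => ->; rewrite ltrDl.
Qed.

Local Close Scope ring_scope.

(** * Dynamic programming and local search *)

(* An option is the vector profit :: indicator vector of a set of vertices.  An
   item pairs the list of all options of a snapshot with the chosen one.  A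
   candidate pairs the key (number of changes left) :: (sum of the chosen
   options) with the items that realise it, latest first. *)
Definition item := (seq (seq nat) * seq nat)%type.
Definition cand := (seq nat * seq item)%type.

Definition vadd (a b : seq nat) : seq nat := [seq p.1 + p.2 | p <- zip a b].

(** One candidate per key suffices, since feasibility and profit of all extensions depend on the key
    alone. Pruning by partial usage is sound because usages only grow. *)
Definition insF (k : nat) (acc : seq cand) (cd : cand) : seq cand :=
  if all (leq^~ k) (behead (behead cd.1)) then
    if has (fun e => cd.1 == e.1) acc then acc else cd :: acc
  else acc.

Definition keepF (it : item) (cd : cand) : cand :=
  (head 0 cd.1 :: vadd it.2 (behead cd.1), it :: cd.2).

Definition moveF (it : item) (cd : cand) (o : seq nat) : cand :=
  ((head 0 cd.1).-1 :: vadd o (behead cd.1), (it.1, o) :: cd.2).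

Definition extF (k : nat) (it : item) (acc : seq cand) (cd : cand) : seq cand :=
  if 0 < head 0 cd.1 then
    foldl (fun a o => insF k a (moveF it cd o)) (insF k acc (keepF it cd)) it.1
  else insF k acc (keepF it cd).

Definition stepF (k : nat) (tab : seq cand) (it : item) : seq cand :=
  foldl (extF k it) [::] tab.

Definition tabF (k K : nat) (z : seq nat) (C : seq item) : seq cand :=
  foldl (stepF k) [:: (K :: z, [::])] C.

(** The start value has an empty key, which reads as profit 0. Ties replace the current candidate,
    so any entry displaces it, and [C] is returned only for an empty table. *)
Definition bestF (C : seq item) (tab : seq cand) : cand :=
  foldl (fun a e => if head 0 (behead a.1) <= head 0 (behead e.1) then e else a)
    ([::], C) tab.

Definition roundF (k K : nat) (z : seq nat) (C : seq item) : seq item :=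
  (bestF C (tabF k K z C)).2.

(** The successors of a candidate as a list: [extF] becomes a fold of [insF] over it, and properties
    of the tables reduce to [foldl_insF]. *)
Definition gens (it : item) (cd : cand) : seq cand :=
  keepF it cd :: (if 0 < head 0 cd.1 then [seq moveF it cd o | o <- it.1] else
      [::]).

Lemma extFE k it acc cd : extF k it acc cd = foldl (insF k) acc (gens it cd).
Proof.
rewrite /extF /gens /=; case: ifP => //= _.
by elim: (it.1) (insF _ _ _) => //= o s IH a; rewrite IH.
Qed.

Lemma foldl_extF k it acc tab :
  foldl (extF k it) acc tab = foldl (insF k) acc (flatten [seq gens it cd | cd
      <- tab]).
Proof.
elim: tab acc => // cd tab IH acc.
by rewrite [LHS]/= IH extFE -foldl_cat.
Qed.

Definition feask (k : nat) (cd : cand) : bool :=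
  all (leq^~ k) (behead (behead cd.1)).

Lemma foldl_insF k (l : seq cand) : let R := foldl (insF k) [::] l in
  [/\ uniq (map fst R), {subset R <= l}, all (feask k) R &
      forall cd, cd \in l -> feask k cd -> exists2 e, e \in R & e.1 = cd.1].
Proof.
elim/last_ind: l => // l cd [uR sR fR cR] /=; rewrite foldl_rcons.
set R := foldl _ _ _ in uR sR fR cR *; rewrite /insF -/(feask k cd).
have sub : {subset l <= rcons l cd} by move=> x;
    rewrite mem_rcons inE orbC => ->.
have old : (forall x, x \in l -> feask k x -> exists2 e, e \in R & e.1 = x.1) ->
   (feask k cd -> exists2 e, e \in R & e.1 = cd.1) ->
   forall x, x \in rcons l cd -> feask k x -> exists2 e, e \in R & e.1 = x.1.
  by move=> h1 h2 x; rewrite mem_rcons inE => /orP[/eqP ->|/h1].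
case: ifP => fc; last first.
  by split=> // [x /sR /sub //|]; apply: old => //; rewrite fc.
case: ifP => hc.
  split=> // [x /sR /sub //|]; apply: old => // _.
  by case/hasP: hc => e eR /eqP ->; exists e.
split=> /=; rewrite ?fc ?uR ?andbT //.
- apply/negP => /mapP[e eR he]; case/negP: hc; apply/hasP; exists e => //.
  by rewrite he.
- by move=> x; rewrite inE mem_rcons inE => /orP[->//|/sR ->]; rewrite orbT.
- move=> x; rewrite mem_rcons inE => /orP[/eqP -> _|xl fx].
    by exists cd; rewrite ?mem_head.
  by have [e eR <-] := cR x xl fx; exists e; rewrite // inE eR orbT.
Qed.

Definition col (j : nat) (C : seq item) : nat := \sum_(it <- C) nth 0 it.2 j.

Definition cols (n : nat) (C : seq item) : seq nat := mkseq (col^~ C) n.+1.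

Definition okopt (n : nat) (o : seq nat) : bool :=
  [&& size o == n.+1, head 0 o <= n.+1 & all (leq^~ 1) (behead o)].

Definition okitem (n : nat) (it : item) : bool :=
  [&& okopt n it.2, all (okopt n) it.1 & it.2 \in it.1].

Definition feas (k n : nat) (C : seq item) : bool :=
  all (leq^~ k) (behead (cols n C)).

Lemma feasP k n C :
  reflect (forall j, 0 < j <= n -> col j C <= k) (feas k n C).
Proof.
rewrite /feas /cols /mkseq /= (iotaDl 1 0) -map_comp; apply: (iffP allP) => h.
  move=> [//|j] hj; apply: h; apply/mapP; exists j => //.
  by rewrite mem_iota add0n.
by move=> _ /mapP[j + ->]; rewrite mem_iota add0n => hj; apply: h.
Qed.

Lemma okopt_nth n o j : okopt n o -> nth 0 o j <= n.+1.
Proof.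
case/and3P=> /eqP sz h0 /allP hb; case: j => [|j]; first by rewrite nth0.
rewrite -nth_behead; case: (ltnP j (size (behead o))) => hj.
  by apply: leq_trans (hb _ (mem_nth _ hj)) _.
by rewrite nth_default.
Qed.

Lemma okopt_nth1 n o j : okopt n o -> 0 < j -> nth 0 o j <= 1.
Proof.
case/and3P=> _ _ /allP hb; case: j => // j _.
rewrite -nth_behead; case: (ltnP j (size (behead o))) => hj.
  exact: hb (mem_nth _ hj).
by rewrite nth_default.
Qed.

Lemma col_cons j it C : col j (it :: C) = nth 0 it.2 j + col j C.
Proof. exact: big_cons. Qed.

Lemma col_rcons j it C : col j (rcons C it) = nth 0 it.2 j + col j C.
Proof. by rewrite /col -cats1 big_cat big_seq1 addnC. Qed.

Lemma col_rev j C : col j (rev C) = col j C.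
Proof. by apply: perm_big; rewrite perm_rev. Qed.

Lemma vadd_cols n (o : seq nat) (ops : seq (seq nat)) D : size o = n.+1 ->
  vadd o (cols n D) = cols n ((ops, o) :: D).
Proof.
move=> sz; apply: (@eq_from_nth _ 0).
  by rewrite size_map size_zip !size_mkseq sz minnn.
move=> j; rewrite size_map size_zip size_mkseq sz minnn => hj.
rewrite (nth_map (0, 0)); last by rewrite size_zip size_mkseq sz minnn.
by rewrite nth_zip ?size_mkseq // !nth_mkseq // col_cons.
Qed.

Definition near (b x y : nat) : Prop := x <= y + b /\ y <= x + b.

(** Invariant of the table after the prefix [P]. With [c] changes left, [K - c] have been spent,
    each altering a coordinate by at most [n.+1]; hence the radius in the last clause, which is
    independent of the length of [P]. *)
Definition entry (n K : nat) (P : seq item) (cd : cand) : Prop :=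
  exists c, [/\ cd.1 = c :: cols n cd.2, c <= K,
    map fst cd.2 = rev (map fst P), all (okitem n) cd.2 &
    forall j, near (n.+1 * (K - c)) (col j cd.2) (col j P)].

Lemma gens_entry n K P it cd e : okitem n it -> entry n K P cd ->
  e \in gens it cd -> entry n K (rcons P it) e.
Proof.
move=> oit [c [kcd cK fcd ocd ncd]].
have [/eqP sit _ _] := and3P (proj1 (andP oit)).
rewrite /gens inE => /orP[/eqP ->|].
  exists c; rewrite /keepF kcd /=; split=> //.
  - by rewrite (vadd_cols it.1) //; case: (it).
  - by rewrite map_rcons rev_rcons fcd.
  - by rewrite oit.
  - by move=> j; rewrite col_rcons col_cons; have := ncd j; rewrite /near; lia.
rewrite kcd /=; case: ifP => // c0 /mapP[o oo ->].
have [ok1 ok2] := andP oit; have [/allP ok3 ok4] := andP ok2.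
have oko := ok3 o oo; have [/eqP so _ _] := and3P oko.
exists c.-1; rewrite /moveF kcd /=; split=> //.
- by rewrite (vadd_cols it.1).
- by lia.
- by rewrite map_rcons rev_rcons fcd.
- by rewrite ocd andbT /okitem /= oko oo andbT; case/andP: ok2.
- move=> j; rewrite col_rcons col_cons /=; have := ncd j; rewrite /near.
  have := okopt_nth j oko; have := okopt_nth j ok1.
  have -> : n.+1 * (K - c.-1) = n.+1 * (K - c) + n.+1.
    by rewrite -mulnSr; congr (_ * _); lia.
  lia.
Qed.

Lemma tabF_entry k n K P : all (okitem n) P ->
  forall cd, cd \in tabF k K (cols n [::]) P -> entry n K P cd /\ feas k n cd.2.
Proof.
elim/last_ind: P => [_|P it IH].
  move=> cd; rewrite inE => /eqP ->; split.
    by exists K; split=> //= j; rewrite /near /=; lia.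
  by apply/feasP => j _; rewrite /col big_nil.
rewrite all_rcons => /andP[oit oP] cd.
rewrite /tabF foldl_rcons -/(tabF _ _ _ _) /stepF foldl_extF.
set l := flatten _; have [_ sub fe _] := foldl_insF k l => ecd.
have /flatten_mapP[cd' cdt eg] := sub _ ecd.
have [en _] := IH oP _ cdt; have en2 := gens_entry oit en eg.
split=> //; have [c [kc _ _ _ _]] := en2.
by have := allP fe _ ecd; rewrite /feask kc.
Qed.

Definition ham (P D : seq item) : nat := count (fun p => p.1 != p.2) (zip P D).

Lemma ham_rcons P D it it' : size P = size D ->
  ham (rcons P it) (rcons D it') = ham P D + (it != it').
Proof. by move=> sz; rewrite /ham zip_rcons // -cats1 count_cat /= addn0. Qed.

Lemma hamxx C : ham C C = 0.
Proof. by elim: C => //= it C; rewrite /ham /= eqxx. Qed.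

(** Induction from the right: where [D] agrees with [P] the last item is kept, elsewhere a change is
    spent. The table may hold another candidate instead of [D], but one with the same key, and the
    keys of successors depend on nothing else. *)
Lemma tabF_complete k n K P D : all (okitem n) P -> all (okitem n) D ->
  map fst D = map fst P -> feas k n D -> ham P D <= K ->
  exists2 cd, cd \in tabF k K (cols n [::]) P &
    cd.1 = (K - ham P D) :: cols n D.
Proof.
elim/last_ind: P D => [|P it IH] D.
  case: D => // _ _ _ _ _; exists (K :: cols n [::], [::]);
      first exact: mem_head.
  by rewrite subn0.
case/lastP: D => [_ _|D it']; first by case: P {IH}.
rewrite !all_rcons !map_rcons => /andP[oit oP] /andP[oit' oD] /eqP.
rewrite eqseq_rcons => /andP[/eqP fD /eqP fit] fe.
have sz : size P = size D by rewrite -(size_map fst D) fD size_map.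
rewrite ham_rcons // => hK.
(* Usages are sums of naturals, so a prefix of a feasible choice is feasible and was not pruned. *)
have feD : feas k n D.
  by apply/feasP => j hj; have := feasP _ _ _ fe j hj; rewrite col_rcons; lia.
have [|cd cdt kcd] := IH D oP oD fD feD; first by lia.
rewrite /tabF foldl_rcons -/(tabF _ _ _ _) /stepF foldl_extF.
set l := flatten _; have [_ _ _ cpl] := foldl_insF k l.
pose target := (K - (ham P D + (it != it'))) :: cols n (rcons D it').
have colsr : cols n (rcons D it') = cols n (it' :: D).
  by apply: eq_map => j; rewrite col_rcons col_cons.
have [/eqP sit' _ _] := and3P (proj1 (andP oit')).
have vE : vadd it'.2 (cols n D) = cols n (it' :: D).
  by rewrite (vadd_cols it'.1) //; case: (it').
suff [e eg ke] : exists2 e, e \in gens it cd & e.1 = target.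
  have [||e' e'R ke'] := cpl e.
  - by apply/flatten_mapP; exists cd.
  - by rewrite /feask ke.
  by exists e' => //; rewrite ke' ke.
rewrite /target colsr -vE; case: (eqVneq it it') hK => [<-|ne] hK.
  by exists (keepF it cd); rewrite ?mem_head // /keepF kcd addn0.
exists (moveF it cd it'.2); last first.
  by rewrite /moveF kcd /= addn1 subnS.
have c0 : 0 < head 0 cd.1 by rewrite kcd /= subn_gt0 -addn1.
rewrite /gens c0 inE; apply/orP; right; apply/mapP; exists it'.2 => //.
by rewrite -fit; case/and3P: oit'.
Qed.

Lemma bestF_max C tab e : e \in tab ->
  head 0 (behead e.1) <= head 0 (behead (bestF C tab).1).
Proof.
rewrite /bestF; elim/last_ind: tab => // tab a IH.
rewrite mem_rcons inE foldl_rcons; set b := foldl _ _ _ in IH *.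
move=> /orP[/eqP ->|/IH h]; case: ifP => // h'; last exact: leq_trans h'.
by rewrite ltnW // ltnNge h'.
Qed.

Lemma bestF_mem C tab : tab != [::] -> bestF C tab \in tab.
Proof.
rewrite /bestF; elim/last_ind: tab => // tab a IH _.
rewrite mem_rcons inE foldl_rcons; case: ifP => h; first by rewrite eqxx.
case: (tab =P [::]) h => [->|/eqP /IH ->]; last by rewrite orbT.
by rewrite leq0n.
Qed.

Lemma roundF_spec k n K C : all (okitem n) C -> feas k n C ->
  let C' := roundF k K (cols n [::]) C in
  [/\ all (okitem n) C', feas k n C', map fst C' = rev (map fst C) &
    forall D, all (okitem n) D -> map fst D = map fst C -> feas k n D ->
      ham C D <= K -> col 0 D <= col 0 C'].
Proof.
move=> oC fC C'; rewrite /roundF in C' *.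
have tab0 : tabF k K (cols n [::]) C != [::].
  have [|cd + _] := @tabF_complete k n K C C oC oC erefl fC;
      first by rewrite hamxx.
  by case: tabF.
have [[c [kc _ fcd ocd _]] fe] := tabF_entry oC (bestF_mem C tab0).
split=> // D oD fD feD hD.
have [cd cdt kcd] := tabF_complete oC oD fD feD hD.
by have := bestF_max C cdt; rewrite kcd kc.
Qed.

(* Every round that starts from a non-optimal choice gains at least one unit of
   profit; a round reverses the order of the items. *)
Lemma iter_roundF_optimal k n C r : all (okitem n) C -> feas k n C ->
  let C' := iter r (roundF k (gbound n) (cols n [::])) C in
  [/\ all (okitem n) C', feas k n C',
      map fst C' = map fst C \/ map fst C' = rev (map fst C) &
      r <= col 0 C' \/
      forall D, all (okitem n) D -> map fst D = map fst C -> feas k n D ->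
        col 0 D <= col 0 C'].
Proof.
move=> oC fC; elim: r => [|r [oR fR mR optR]] /=; first by split=> //; left.
set R := iter r _ _ in oR fR mR optR *.
have [o' f' m' best] := roundF_spec (gbound n) oR fR.
set R' := roundF _ _ _ _ in o' f' m' best *.
have mono : col 0 R <= col 0 R'.
  by apply: best; rewrite ?hamxx.
split=> //.
  by rewrite m'; case: mR => ->; [right|left; rewrite revK].
case: optR => [hr|h]; last by right=> D oD mD fD;
    apply: leq_trans (h D oD mD fD) mono.
(* In the second case the round gained nothing, as [R] already had profit at least [r]; a choice
   better than [R'] then leads to a contradiction. *)
case: (leqP r.+1 (col 0 R')) => hR'; first by left.
right=> D0 oD0 mD0 fD0; rewrite leqNgt; apply/negP => hlt.
(* [D0] follows the order of [C], and [R] possibly the reverse one; [D] is [D0] in the order of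
   [R]. *)
have [D [oD mD fD cD]] : exists D, [/\ all (okitem n) D, map fst D = map fst R,
    feas k n D & col 0 D = col 0 D0].
  case: mR => mR; first by exists D0; rewrite mR.
  exists (rev D0); rewrite all_rev col_rev mR map_rev mD0; split=> //.
  by apply/feasP => j hj; rewrite col_rev; apply: (feasP _ _ _ fD0).
have szD : size D = size R by rewrite -(size_map fst) mD size_map.
pose it0 : item := ([::], [::]).
pose x i j := nth 0 (nth it0 R i).2 j; pose y i j := nth 0 (nth it0 D i).2 j.
have colE E j : col j E = \sum_(i <- iota 0 (size E)) nth 0 (nth it0 E i).2 j.
  by rewrite /col (big_nth it0) /index_iota subn0.
have bit E i j : all (okitem n) E -> 0 < j <= n -> nth 0 (nth it0 E i).2 j <= 1.
  move=> oE /andP[j0 _]; case: (ltnP i (size E)) => hi.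
    apply: (@okopt_nth1 n) => //.
    by have := allP oE _ (mem_nth it0 hi) => /and3P[].
  by rewrite [nth it0 E i]nth_default // nth_nil.
have [S [szS feS gain]] : exists S : seq nat, [/\ size S <= gbound n,
    forall j, 0 < j <= n ->
      \sum_(i <- iota 0 (size R)) (if i \in S then y i j else x i j) <= k &
    \sum_(i <- iota 0 (size R)) x i 0 <
     \sum_(i <- iota 0 (size R)) (if i \in S then y i 0 else x i 0)].
  apply: improving_swap.
  - by move=> i j hj; split; apply: bit.
  - move=> j hj; rewrite -colE -szD -colE; split.
      exact: (feasP _ _ _ fR).
    exact: (feasP _ _ _ fD).
  - by rewrite -colE -szD -colE cD; lia.
(* [R] with the choices of [D] at the positions in [S]: its Hamming distance from [R] is at most
   [size S], so it is among the choices over which the round maximises. *)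
pose E := mkseq (fun i => if i \in S then nth it0 D i else nth it0 R i) (size
    R).
have nthE i : i < size R -> nth it0 E i = if i \in S then nth it0 D i else nth
    it0 R i.
  by move=> hi; rewrite nth_mkseq.
have szE : size E = size R by rewrite size_mkseq.
have colEE j : col j E =
    \sum_(i <- iota 0 (size R)) (if i \in S then y i j else x i j).
  rewrite colE szE big_seq [RHS]big_seq; apply: eq_bigr => i.
  by rewrite mem_iota add0n => /nthE ->; case: ifP.
suff : col 0 E <= col 0 R'.
  by rewrite colEE; move: gain; rewrite -colE; lia.
apply: best.
- apply/(all_nthP it0) => i; rewrite szE => hi; rewrite nthE //.
  by case: ifP => _; [apply: (allP oD)|apply: (allP oR)]; rewrite mem_nth ?szD.
- apply: (@eq_from_nth _ [::]); first by rewrite !size_map size_iota.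
  move=> i; rewrite size_map szE => hi.
  rewrite !(nth_map it0) ?szE // nthE //; case: ifP => // _.
  by rewrite -(nth_map it0 [::]) ?szD // mD (nth_map it0).
- by apply/feasP => j hj; rewrite colEE feS.
- rewrite /ham; apply: leq_trans szS.
  have -> : zip R E = [seq (nth it0 R i, nth it0 E i) | i <- iota 0 (size R)].
    apply: (@eq_from_nth _ (it0, it0)).
      by rewrite size_zip size_map size_iota szE minnn.
    move=> i; rewrite size_zip szE minnn => hi.
    by rewrite nth_zip // (nth_map 0) ?size_iota // nth_iota.
  rewrite count_map -size_filter; apply: uniq_leq_size.
    by rewrite filter_uniq // iota_uniq.
  move=> i; rewrite mem_filter mem_iota add0n /= => /andP[+ hi].
  by rewrite nthE //; case: ifP => // _; rewrite eqxx.
Qed.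

(** * Size of the tables *)

Fixpoint box (b : nat) (bs : seq nat) : seq (seq nat) :=
  if bs is x :: bs' then [seq y :: v | y <- iota (x - b) (2 * b + 1), v <- box
      b bs']
  else [:: [::]].

Lemma size_box b bs : size (box b bs) = (2 * b).+1 ^ size bs.
Proof. by elim: bs => //= x bs IH; rewrite size_allpairs size_iota IH addn1
    expnS. Qed.

(** If [x < b], the truncated [x - b] is 0 and the interval extends beyond [x + b]; it contains all
    values near [x] in either case. *)
Lemma mem_box b bs v : size v = size bs ->
  (forall j, near b (nth 0 v j) (nth 0 bs j)) -> v \in box b bs.
Proof.
elim: bs v => [|x bs IH] [|y v] //= [sz] h.
apply: allpairs_f; last by apply: IH => // j; apply: (h j.+1).
by have := h 0; rewrite mem_iota /near /=; lia.
Qed.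

(** The number of points in a box of radius [n.+1 * K] with [n.+2] coordinates: the changes left,
    the profit and [n] usages. *)
Definition tabsize (n K : nat) : nat := (2 * (n.+1 * K)).+1 ^ n.+2.

(** The keys of a table are distinct and lie in the box around [K :: cols n P]; only its centre
    depends on [P]. *)
Lemma size_foldl_insF k n K P (l : seq cand) :
  (forall cd, cd \in l -> entry n K P cd) ->
  size (foldl (insF k) [::] l) <= tabsize n K.
Proof.
move=> hl; have [u sub _ _] := foldl_insF k l.
have /(uniq_leq_size u) : {subset map fst (foldl (insF k) [::] l) <=
    box (n.+1 * K) (K :: cols n P)}; last first.
    by rewrite size_box /= !size_map /= size_iota.
  move=> _ /mapP[cd /sub/hl[c [kc cK _ _ nr]] ->].
  rewrite kc; apply: mem_box; first by rewrite /= !size_map.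
  case=> [|j] /=; first by rewrite /near mulSn; lia.
  case: (ltnP j n.+1) => hj; last by rewrite !nth_default ?size_mkseq // /near;
      lia.
  rewrite !nth_mkseq //; have := nr j.
  have : n.+1 * (K - c) <= n.+1 * K by rewrite leq_mul2l leq_subr orbT.
  rewrite /near; lia.
Qed.

Lemma col_le n C j : all (okitem n) C -> col j C <= n.+1 * size C.
Proof.
elim: C => [|it C IH] /=; first by rewrite /col big_nil.
case/andP=> /and3P[h _ _] /IH; rewrite col_cons mulnS.
by have := okopt_nth j h; lia.
Qed.

(** * Terms of the functional language *)

Arguments unary : simpl never.

(** Value and safety are proved together, since the length of a traversed list is known only through
    its value. *)
Definition ev (M : nat) (env : seq tree) (t : tm) (v : tree) : Prop :=
  tsem env t = v /\ safe M env t.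

Lemma ev_var M env i v : nth Leaf env i = v -> ev M env (TVar i) v.
Proof. by []. Qed.

Lemma ev_nil M env : ev M env TNil Leaf.
Proof. by []. Qed.

Lemma ev_cons M env a b v w :
  ev M env a v -> ev M env b w -> ev M env (TCons a b) (Node v w).
Proof. by rewrite /ev /= => -[-> ?] [-> ?]. Qed.

Lemma ev_hd M env a v w : ev M env a v -> thd v = w -> ev M env (THd a) w.
Proof. by rewrite /ev /= => -[-> ?]. Qed.

Lemma ev_tl M env a v w : ev M env a v -> ttl v = w -> ev M env (TTl a) w.
Proof. by rewrite /ev /= => -[-> ?]. Qed.

Lemma ev_ite M env c x y vc b v w : ev M env c vc -> truthy vc = b ->
  (b -> ev M env x v) -> (~~ b -> ev M env y w) ->
  ev M env (TIte c x y) (if b then v else w).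
Proof.
rewrite /ev /= => -[-> ?] ->.
by case: b => h1 h2; [have [-> ?] := h1 isT|have [-> ?] := h2 isT]; split.
Qed.

Lemma ev_let M env a b v w :
  ev M env a v -> ev M (v :: env) b w -> ev M env (TLet a b) w.
Proof. by rewrite /ev /= => -[-> ?] [-> ?]. Qed.

Lemma ev_call M env f a b c d va vb vc vd v :
  ev M env a va -> ev M env b vb -> ev M env c vc -> ev M env d vd ->
  ev M [:: va; vb; vc; vd] f v -> ev M env (TCall f a b c d) v.
Proof. by rewrite /ev /= => -[-> ?] [-> ?] [-> ?] [-> ?] [-> ?]. Qed.

Lemma ev_eq M env t v w : ev M env t v -> v = w -> ev M env t w.
Proof. by move=> h <-. Qed.

Lemma tlen_enc_seq s : tlen (enc_seq s) = size s.
Proof. by elim: s => //= x s ->. Qed.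

(** Relates a fold on trees to a fold [F] on the encoded data. The body is examined only at
    accumulators that are reached, so their invariants are available. *)
Lemma ev_fold M env tl ti tb (X A : Type) (eX : X -> tree) (eA : A -> tree)
    (F : A -> X -> A) (a0 : A) (xs : seq X) :
  ev M env tl (enc_seq (map eX xs)) -> size xs <= M -> ev M env ti (eA a0) ->
  (forall pre x post, xs = pre ++ x :: post ->
    ev M [:: eX x, eA (foldl F a0 pre) & env] tb (eA (F (foldl F a0 pre) x))) ->
  ev M env (TFold tl ti tb) (eA (foldl F a0 xs)).
Proof.
rewrite /ev /= => -[-> ?] hs [-> ?] hb; rewrite tlen_enc_seq size_map.
have key ys pre a : xs = pre ++ ys -> a = foldl F a0 pre ->
   tfoldl (fun acc h => tsem [:: h, acc & env] tb) (eA a) (enc_seq (map eX ys))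
       =
     eA (foldl F a ys) /\
   sfold (fun acc h => tsem [:: h, acc & env] tb)
     (fun acc h => safe M [:: h, acc & env] tb) (eA a) (enc_seq (map eX ys)).
  elim: ys pre a => [|x ys IH] pre a //= e ea.
  have [h1 h2] := hb pre x ys e; rewrite -ea in h1 h2; rewrite h1.
  have [||h3 h4] := IH (rcons pre x) (F a x); first by rewrite cat_rcons.
    by rewrite foldl_rcons ea.
  by split.
by have [h1 h2] := key xs [::] a0 erefl erefl; split.
Qed.

Lemma ev_foldI M env tl ti tb (X : eqType) (A : Type)
    (Inv : A -> Prop) (eX : X -> tree) (eA : A -> tree)
    (F : A -> X -> A) (a0 : A) (xs : seq X) :
  ev M env tl (enc_seq (map eX xs)) -> size xs <= M -> ev M env ti (eA a0) ->
  Inv a0 -> (forall a x, Inv a -> x \in xs -> Inv (F a x)) ->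
  (forall a x, Inv a -> x \in xs ->
    ev M [:: eX x, eA a & env] tb (eA (F a x))) ->
  ev M env (TFold tl ti tb) (eA (foldl F a0 xs)).
Proof.
move=> hl hs hi h0 hI hb; apply: ev_fold hl hs hi _ => pre x post e.
apply: hb; last by rewrite e mem_cat mem_head orbT.
have : {subset pre <= xs} by move=> y hy; rewrite e mem_cat hy.
elim/last_ind: pre {e} => // pre y IH hsub; rewrite foldl_rcons.
apply: hI; last by apply: hsub; rewrite mem_rcons mem_head.
by apply: IH => z hz; apply: hsub; rewrite mem_rcons inE hz orbT.
Qed.

Lemma unaryE m : unary m = enc_seq (nseq m Leaf).
Proof. by elim: m => //= m; rewrite /unary /= => ->. Qed.

Lemma ev_fold_unary M env tl ti tb (A : Type) (eA : A -> tree) (F : A -> A)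
    (a0 : A) m :
  ev M env tl (unary m) -> m <= M -> ev M env ti (eA a0) ->
  (forall j, j < m -> ev M [:: Leaf, eA (iter j F a0) & env] tb
                        (eA (iter j.+1 F a0))) ->
  ev M env (TFold tl ti tb) (eA (iter m F a0)).
Proof.
move=> hl hm hi hb.
have E j : foldl (fun a (_ : tree) => F a) a0 (nseq j Leaf) = iter j F a0.
  by elim: j (a0) => // j IH a; rewrite /= IH -iterSr.
rewrite -E; apply: (ev_fold (eX := id)) => //; first by rewrite map_id -unaryE.
  by rewrite size_nseq.
move=> pre x post e.
have szp : size pre < m.
  by rewrite -(size_nseq m Leaf) e size_cat /= addnS ltnS leq_addr.
have -> : pre = nseq (size pre) Leaf.
  have := congr1 (take (size pre)) e.
  by rewrite take_size_cat // take_nseq ?(ltnW szp).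
have -> : x = Leaf.
  have := congr1 (nth Leaf ^~ (size pre)) e.
  by rewrite nth_cat ltnn subnn /= nth_nseq szp.
by rewrite E; apply: hb.
Qed.

(** * Arithmetic and vectors in unary *)

Definition encv (v : seq nat) : tree := enc_seq (map unary v).

Lemma thd_encv v : thd (encv v) = unary (head 0 v).
Proof. by case: v. Qed.

Lemma ttl_encv v : ttl (encv v) = encv (behead v).
Proof. by case: v. Qed.

Lemma ttl_unary m : ttl (unary m) = unary m.-1.
Proof. by case: m. Qed.

Lemma truthy_bool b : truthy (enc_bool b) = b.
Proof. by case: b. Qed.

Lemma truthy_unary m : truthy (unary m) = (0 < m).
Proof. by case: m. Qed.

Lemma unary_bool (b : bool) : unary b = enc_bool b.
Proof. by case: b. Qed.

Definition encE := (thd_encv, ttl_encv, ttl_unary, truthy_bool, truthy_unary).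

Ltac evcall := fail.
Ltac evs :=
  lazymatch goal with
  | |- ev _ _ (TVar _) _ => eapply ev_var; simpl; reflexivity
  | |- ev _ _ TNil _ => apply ev_nil
  | |- ev _ _ (TCons _ _) _ => eapply ev_cons; [evs | evs]
  | |- ev _ _ (THd _) _ => eapply ev_hd; [evs | rewrite ?encE /=; reflexivity]
  | |- ev _ _ (TTl _) _ => eapply ev_tl; [evs | rewrite ?encE /=; reflexivity]
  | |- ev _ _ (TCall _ _ _ _ _) _ =>
      eapply ev_call; [evs | evs | evs | evs | evcall]
  | |- _ => idtac
  end.

Notation TCall1 f a := (TCall f a TNil TNil TNil).
Notation TCall2 f a b := (TCall f a b TNil TNil).

Notation tTrue := (TCons TNil TNil).

Definition revT := TFold (TVar 0) TNil (TCons (TVar 0) (TVar 1)).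

Lemma foldl_consE (X Y : Type) (f : X -> Y) xs s :
  foldl (fun a x => f x :: a) s xs = rev (map f xs) ++ s.
Proof.
by elim: xs s => //= x xs IH s; rewrite IH rev_cons cat_rcons.
Qed.

Lemma revT_ev M ts b c d : size ts <= M ->
  ev M [:: enc_seq ts; b; c; d] revT (enc_seq (rev ts)).
Proof.
move=> hs; have -> : rev ts = foldl (fun a x => id x :: a) [::] ts.
  by rewrite foldl_consE map_id cats0.
by apply: (ev_fold (eX := id) (eA := enc_seq)) => [|||pre x post _];
    rewrite ?map_id.
Qed.

Definition addT := TFold (TVar 0) (TVar 1) (TCons TNil (TVar 1)).

Lemma addT_ev M a b c d : a <= M ->
  ev M [:: unary a; unary b; c; d] addT (unary (a + b)).
Proof.
move=> ha; have -> : a + b = iter a S b by elim: a {ha} => //= a <-.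
by apply: ev_fold_unary => // j _; evs.
Qed.

Definition mulT := TFold (TVar 0) TNil (TFold (TVar 3) (TVar 1) (TCons TNil
    (TVar 1))).

(** Stated for the lengths of arbitrary lists, so that the number of snapshots can be taken from the
    list of snapshots without conversion to a numeral. *)
Lemma mulT_ev M s1 s2 c d : size s1 <= M -> size s2 <= M ->
  ev M [:: enc_seq s1; enc_seq s2; c; d] mulT (unary (size s1 * size s2)).
Proof.
move=> h1 h2; have E m a (s : seq tree) : foldl (fun a _ =>
    m + a) a s = size s * m + a.
  by elim: s a => //= _ s IH a; rewrite IH mulSn; lia.
have -> : size s1 * size s2 = foldl (fun a _ => size s2 + a) 0 s1.
  by rewrite E addn0.
apply: (ev_fold (eX := id)) => [|||pre x post _]; rewrite ?map_id //.
have -> a : size s2 + a = foldl (fun a _ => a.+1) a s2.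
  by elim: (s2) a => //= _ s IH a; rewrite -IH; lia.
by apply: (ev_fold (eX := id) (eA := unary)) => [|||pre' x' post' _];
  rewrite ?map_id.
Qed.

Lemma mulT_unary M a b c d : a <= M -> b <= M ->
  ev M [:: unary a; unary b; c; d] mulT (unary (a * b)).
Proof.
move=> h1 h2; rewrite !(unaryE a) !(unaryE b).
by have := @mulT_ev M (nseq a Leaf) (nseq b Leaf) c d; rewrite !size_nseq;
    apply.
Qed.

Definition subT := TFold (TVar 1) (TVar 0) (TTl (TVar 1)).

Lemma subT_ev M a b c d : b <= M ->
  ev M [:: unary a; unary b; c; d] subT (unary (a - b)).
Proof.
move=> hb; have -> : a - b = iter b predn a.
  by elim: b {hb} => [|b IH]; rewrite ?subn0 // subnS IH.
by apply: ev_fold_unary => // j _; evs.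
Qed.

Definition leqT := TIte (TCall2 subT (TVar 0) (TVar 1)) TNil tTrue.

Lemma leqT_ev M a b c d : b <= M ->
  ev M [:: unary a; unary b; c; d] leqT (enc_bool (a <= b)).
Proof.
move=> hb; have -> : enc_bool (a <= b) =
    if 0 < a - b then Leaf else Node Leaf Leaf.
  by rewrite subn_gt0 ltnNge; case: (a <= b).
apply: ev_ite => [|||]; last by move=> _; evs.
- by eapply ev_call; [evs|evs|evs|evs|apply: subT_ev].
- by rewrite truthy_unary.
- by evs.
Qed.

Definition minT := TCall2 subT (TVar 0) (TCall2 subT (TVar 0) (TVar 1)).

Lemma minT_ev M a b c d : a <= M -> b <= M ->
  ev M [:: unary a; unary b; c; d] minT (unary (minn a b)).
Proof.
move=> ha hb; have -> : minn a b = a - (a - b) by lia.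
eapply ev_call; [evs| |evs|evs|apply: subT_ev; lia].
by eapply ev_call; [evs|evs|evs|evs|apply: subT_ev].
Qed.

(** The accumulator pairs the unread rest of the second list with the reversed output. *)
Definition zipT := TCall1 revT (TTl (TFold (TVar 0) (TCons (TVar 1) TNil)
  (TCons (TTl (THd (TVar 1)))
        (TCons (TCons (TVar 0) (THd (THd (TVar 1)))) (TTl (TVar 1)))))).

Definition encp (p : tree * tree) : tree := Node p.1 p.2.

Lemma zipT_ev M s1 s2 c d : size s1 = size s2 -> size s1 <= M ->
  ev M [:: enc_seq s1; enc_seq s2; c; d] zipT (enc_seq (map encp (zip s1 s2))).
Proof.
move=> hs hM.
pose F (a : seq tree * seq (tree * tree)) x :=
  (behead a.1, (x, head Leaf a.1) :: a.2).
pose eA (a : seq tree * seq (tree * tree)) :=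
  Node (enc_seq a.1) (enc_seq (map encp a.2)).
have FE o : foldl F (s2, o) s1 = ([::], rev (zip s1 s2) ++ o).
  elim: s1 s2 o hs {hM} => [|x s1 IH] [|y s2] o //= [hs].
  by rewrite IH // rev_cons cat_rcons.
eapply ev_call; [|evs|evs|evs|].
- eapply ev_tl.
    apply: (@ev_fold _ _ _ _ _ _ _ id eA F (s2, [::]) s1) => [|||pre x post _].
    + by rewrite map_id; evs.
    + by [].
    + by [].
    + by case: (foldl _ _ pre) => -[|y r] o; rewrite /eA /F /=; evs.
  by rewrite FE cats0 /=; reflexivity.
- have -> : map encp (zip s1 s2) = rev (map encp (rev (zip s1 s2))).
    by rewrite map_rev revK.
  by apply: revT_ev; rewrite size_map size_rev size_zip hs minnn -hs.
Qed.

Ltac evcall ::= first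
  [ eapply revT_ev | eapply addT_ev | eapply mulT_unary | eapply subT_ev
  | eapply leqT_ev | eapply minT_ev | eapply zipT_ev ].

Definition encpair (X Y : Type) (eX : X -> tree) (eY : Y -> tree) (p : X * Y) :=
  Node (eX p.1) (eY p.2).

Lemma zipT_map M (X Y : Type) (eX : X -> tree) (eY : Y -> tree) a b c d :
  size a = size b -> size a <= M ->
  ev M [:: enc_seq (map eX a); enc_seq (map eY b); c; d] zipT
    (enc_seq (map (encpair eX eY) (zip a b))).
Proof.
move=> hs hM.
have -> : map (encpair eX eY) (zip a b) = map encp (zip (map eX a) (map eY b)).
  by elim: a b {hs hM} => [|x a IH] [|y b] //=; rewrite IH.
by apply: zipT_ev; rewrite !size_map.
Qed.

Definition vaddT := TCall1 revT (TFold (TCall2 zipT (TVar 0) (TVar 1)) TNil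
  (TCons (TCall2 addT (THd (TVar 0)) (TTl (TVar 0))) (TVar 1))).

Lemma mem_zip (S T : eqType) (s : seq S) (t : seq T) p :
  p \in zip s t -> p.1 \in s /\ p.2 \in t.
Proof.
elim: s t => [|x s IH] [|y t] //=; rewrite !inE => /orP[/eqP ->|/IH[-> ->]] /=.
  by rewrite !eqxx.
by rewrite !orbT.
Qed.

Lemma vaddT_ev M a b c d : size a = size b -> size a <= M ->
  all (leq^~ M) a ->
  ev M [:: encv a; encv b; c; d] vaddT (encv (vadd a b)).
Proof.
move=> hs hM /allP ha.
have -> : encv (vadd a b) = enc_seq (rev (map unary (rev (vadd a b)))).
  by rewrite map_rev revK.
have sz : size (zip a b) <= M by rewrite size_zip hs minnn -hs.
eapply ev_call; [|evs|evs|evs|]; last first.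
  by apply: revT_ev; rewrite size_map size_rev size_map.
have -> : enc_seq (map unary (rev (vadd a b))) = encv (foldl
    (fun acc (p : nat * nat) => (p.1 + p.2) :: acc) [::] (zip a b)).
  by rewrite foldl_consE cats0.
apply: (ev_foldI (Inv := fun=> True) (eX := encpair unary unary) (eA := encv))
    => //.
  by eapply ev_call; [evs|evs|evs|evs|apply: zipT_map].
by move=> acc p _ /mem_zip[/ha hp _]; evs.
Qed.

Definition eqvT := TFold (TCall2 zipT (TVar 0) (TVar 1)) tTrue
  (TIte (TCall2 leqT (THd (TVar 0)) (TTl (TVar 0)))
    (TIte (TCall2 leqT (TTl (TVar 0)) (THd (TVar 0))) (TVar 1) TNil) TNil).

Lemma eqvT_ev M a b c d : size a = size b -> size a <= M ->
  all (leq^~ M) a -> all (leq^~ M) b ->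
  ev M [:: encv a; encv b; c; d] eqvT (enc_bool (a == b)).
Proof.
move=> hs hM /allP ha /allP hb.
have sz : size (zip a b) <= M by rewrite size_zip hs minnn -hs.
have -> : (a == b) = foldl (fun acc (p : nat * nat) => if p.1 <= p.2 then
    if p.2 <= p.1 then acc else false else false) true (zip a b).
  rewrite -[LHS]andTb; elim: a b (true) hs {hM ha hb sz} =>
      [|x a IH] [|y b] t //=.
    by rewrite andbT.
  case=> hs; rewrite -IH // eqseq_cons eqn_leq.
  by case: (x <= y); case: (y <= x); rewrite ?andbF.
apply: (ev_foldI (Inv := fun=> True) (eX := encpair unary unary) (eA :=
    enc_bool)) => //.
  by eapply ev_call; [evs|evs|evs|evs|apply: zipT_map].
move=> acc p _ /mem_zip[/ha h1 /hb h2].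
rewrite (fun_if enc_bool); apply: ev_ite => [|||_].
- by evs.
- by rewrite truthy_bool.
- move=> _; rewrite (fun_if enc_bool); apply: ev_ite => [|||_].
  + by evs.
  + by rewrite truthy_bool.
  + by evs.
  + by evs.
- by evs.
Qed.

Definition allleqT := TFold (TVar 0) tTrue
  (TIte (TCall2 leqT (TVar 0) (TVar 3)) (TVar 1) TNil).

Lemma allleqT_ev M v k c d : size v <= M -> k <= M ->
  ev M [:: encv v; unary k; c; d] allleqT (enc_bool (all (leq^~ k) v)).
Proof.
move=> hs hk; have -> : all (leq^~ k) v = foldl (fun acc x =>
    if x <= k then acc else false) true v.
  rewrite -[LHS]andTb; elim: v (true) {hs} => [|x v IH] t /=;
      first by rewrite andbT.
  by rewrite -IH; case: leqP; rewrite ?andbF.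
apply: (ev_foldI (Inv := fun=> True) (eX := unary) (eA := enc_bool)) => //.
move=> acc x _ _; rewrite (fun_if enc_bool); apply: ev_ite => [|||_];
    try by evs.
by rewrite truthy_bool.
Qed.

(** * The dynamic program on encoded tables *)

Definition encit (it : item) : tree := Node (enc_seq (map encv it.1)) (encv
    it.2).
Definition encC (C : seq item) : tree := enc_seq (map encit C).
Definition enccd (cd : cand) : tree := Node (encv cd.1) (encC cd.2).
Definition enctab (tab : seq cand) : tree := enc_seq (map enccd tab).

Definition okkey (M m : nat) (key : seq nat) : bool :=
  (size key == m) && all (leq^~ M) key.

Definition memT := TFold (TVar 1) TNil
  (TIte (TCall2 eqvT (TVar 2) (THd (TVar 0))) tTrue (TVar 1)).

Lemma memT_ev M m key tab c d : size tab <= M -> m <= M -> okkey M m key ->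
  (forall e, e \in tab -> okkey M m e.1) ->
  ev M [:: encv key; enctab tab; c; d] memT
    (enc_bool (has (fun e => key == e.1) tab)).
Proof.
move=> hs hm /andP[/eqP sk ak] ht.
have -> : has (fun e => key == e.1) tab = foldl (fun acc (e : cand) =>
    if key == e.1 then true else acc) false tab.
  rewrite -[LHS]orFb; elim: tab (false) {hs ht} => [|x v IH] t /=;
      first by rewrite orbF.
  by rewrite -IH; case: ifP; rewrite ?orbT.
apply: (ev_foldI (Inv := fun=> True) (eX := enccd) (eA := enc_bool)) => //.
move=> acc e _ /ht /andP[/eqP se ae]; rewrite (fun_if enc_bool).
apply: ev_ite => [|||_]; try by evs.
- eapply ev_call; [evs|evs|evs|evs|].
  by apply: eqvT_ev; rewrite ?sk ?se.
- by rewrite truthy_bool.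
Qed.

Definition insT := TIte (TCall2 allleqT (TTl (TTl (TVar 1))) (TVar 3))
  (TIte (TCall2 memT (TVar 1) (TVar 0)) (TVar 0)
     (TCons (TCons (TVar 1) (TVar 2)) (TVar 0))) (TVar 0).

Lemma insT_ev M m acc key ch k : size acc <= M -> m <= M -> okkey M m key ->
  (forall e, e \in acc -> okkey M m e.1) -> k <= M ->
  ev M [:: enctab acc; encv key; encC ch; unary k] insT
    (enctab (insF k acc (key, ch))).
Proof.
move=> hs hm hk ha hkM; rewrite /insF /= (fun_if enctab).
apply: ev_ite => [|||_]; try by evs.
- eapply ev_call; [evs|evs|evs|evs|]; apply: allleqT_ev => //.
  by case/andP: hk => /eqP sk _; rewrite !size_behead sk; lia.
- by rewrite truthy_bool.
move=> _; rewrite (fun_if enctab); apply: ev_ite => [|||_]; try by evs.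
- by eapply ev_call; [evs|evs|evs|evs|]; apply: memT_ev hk ha.
- by rewrite truthy_bool.
Qed.

Definition extT := TLet
  (TCall insT (TVar 0)
     (TCons (THd (THd (TVar 1)))
            (TCall2 vaddT (TTl (TVar 2)) (TTl (THd (TVar 1)))))
     (TCons (TVar 2) (TTl (TVar 1))) (TVar 3))
  (TIte (THd (THd (TVar 2)))
     (TFold (THd (TVar 3)) (TVar 0)
       (TCall insT (TVar 1)
         (TCons (TTl (THd (THd (TVar 4))))
            (TCall2 vaddT (TVar 0) (TTl (THd (TVar 4)))))
         (TCons (TCons (THd (TVar 5)) (TVar 0)) (TTl (TVar 4))) (TVar 6)))
     (TVar 0)).

Definition stepT := TFold (TVar 0) TNil
  (TCall extT (TVar 1) (TVar 0) (TVar 3) (TVar 4)).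

Definition tabT := TFold (TVar 0) (TCons (TCons (TCons (TVar 2) (TVar 3)) TNil)
    TNil)
  (TCall stepT (TVar 1) (TVar 0) (TVar 3) TNil).

Definition bestT := TFold (TVar 1) (TCons TNil (TVar 0))
  (TIte (TCall2 leqT (THd (TTl (THd (TVar 1)))) (THd (TTl (THd (TVar 0)))))
     (TVar 0) (TVar 1)).

Definition roundT := TTl (TCall2 bestT (TVar 0)
  (TCall tabT (TVar 0) (TVar 1) (TVar 2) (TVar 3))).

Definition fits (M n K k T : nat) : Prop :=
  [/\ n.+2 <= M, K <= M, k <= M, n.+1 * T <= M & tabsize n K <= M].

(** Safety concerns the unfinished tables too. Each of them is a fold of [insF] over entries for the
    same prefix, so [size_foldl_insF] bounds it as well. *)
Definition reach (k n K : nat) (P : seq item) (a : seq cand) : Prop :=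
  exists2 l, (forall cd, cd \in l -> entry n K P cd) & a = foldl (insF k) [::]
      l.

Lemma reach_nil k n K P : reach k n K P [::].
Proof. by exists [::]. Qed.

Lemma reach_insF k n K P a cd : reach k n K P a -> entry n K P cd ->
  reach k n K P (insF k a cd).
Proof.
move=> [l hl ->] hcd; exists (rcons l cd); last by rewrite foldl_rcons.
by move=> e; rewrite mem_rcons inE => /orP[/eqP ->|/hl].
Qed.

Lemma reach_size k n K P a : reach k n K P a -> size a <= tabsize n K.
Proof. by move=> [l hl ->]; apply: size_foldl_insF hl. Qed.

Lemma reach_entry k n K P a cd : reach k n K P a -> cd \in a -> entry n K P cd.
Proof. by move=> [l hl ->]; have [_ sub _ _] := foldl_insF k l => /sub/hl. Qed.

Lemma entry_okkey M n K k T P cd : fits M n K k T -> size P <= T ->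
  entry n K P cd -> okkey M n.+2 cd.1.
Proof.
move=> [h1 h2 _ h3 _] hP [c [-> cK fP ok _]];
    rewrite /okkey /= size_map size_iota eqxx.
rewrite (leq_trans cK h2) /=; change (all (leq^~ M) (cols n cd.2)).
apply/allP => _ /mapP[j _ ->]; apply: leq_trans (col_le j ok) _.
have -> : size cd.2 = size P by rewrite -(size_map fst) fP size_rev size_map.
by apply: leq_trans h3; rewrite leq_mul2l hP.
Qed.

Lemma okopt_all M n o : n.+2 <= M -> okopt n o -> all (leq^~ M) o.
Proof.
move=> hM ho; apply/(all_nthP 0) => i _.
by apply: leq_trans (okopt_nth i ho) _; lia.
Qed.

Lemma reach_extF k n K P it a cd : okitem n it -> entry n K P cd ->
  reach k n K (rcons P it) a -> reach k n K (rcons P it) (extF k it a cd).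
Proof.
move=> oit en; rewrite extFE => ra.
have := gens_entry oit en; elim: (gens it cd) a ra => //= e l IH a ra h.
apply: IH; last by move=> x xl; apply: h; rewrite inE xl orbT.
by apply: reach_insF => //; apply: h; rewrite mem_head.
Qed.

Lemma extT_ev M n K k T P it cd acc : fits M n K k T -> size P < T ->
  okitem n it -> size it.1 <= M -> entry n K P cd ->
  reach k n K (rcons P it) acc ->
  ev M [:: enctab acc; enccd cd; encit it; unary k] extT
    (enctab (extF k it acc cd)).
Proof.
move=> ft hP oit sit en ra; have [f1 f2 f3 f4 f5] := ft.
have gen := gens_entry oit en.
have hP' : size (rcons P it) <= T by rewrite size_rcons.
have okr a : reach k n K (rcons P it) a -> size a <= M /\
    forall e, e \in a -> okkey M n.+2 e.1.
  move=> r; split; first exact: leq_trans (reach_size r) f5.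
  by move=> e /(reach_entry r)/(entry_okkey ft hP').
have [c [kc cK _ _ _]] := en.
have sb : size (behead cd.1) = n.+1 by rewrite kc /= size_map size_iota.
have vev o c' d' : okopt n o ->
    ev M [:: encv o; encv (behead cd.1); c'; d'] vaddT (encv (vadd o (behead
        cd.1))).
  move=> oo; apply: vaddT_ev; last exact: okopt_all oo.
    by case/and3P: oo => /eqP -> _ _.
  by case/and3P: oo => /eqP -> _ _; lia.
have [o2 /allP o1 _] := and3P oit.
have kg : keepF it cd \in gens it cd by rewrite mem_head.
have [s1 k1] := okr _ ra.
have r1 : reach k n K (rcons P it) (insF k acc (keepF it cd)).
  by apply: reach_insF => //; apply: gen.
have ins1 : ev M [:: enctab acc; encv (keepF it cd).1; encC (keepF it cd).2;
    unary k]
    insT (enctab (insF k acc (keepF it cd))).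
  by apply: (@insT_ev M n.+2) => //; apply: (entry_okkey ft hP'); apply: gen.
apply: (ev_let (v := enctab (insF k acc (keepF it cd)))).
  eapply ev_call; [evs| |evs|evs|exact: ins1].
  by apply: ev_cons; [evs|eapply ev_call; [evs|evs|evs|evs|exact: vev]].
rewrite /extF (fun_if enctab); apply: ev_ite => [|||_].
- by evs.
- by rewrite truthy_unary.
- move=> c0; apply: (ev_foldI (Inv := reach k n K (rcons P it)) (eX := encv)
    (eA := enctab)) => //.
  + move=> a o ra' oo; apply: reach_insF => //; apply: gen.
    by rewrite /gens c0 inE; apply/orP; right; apply: map_f.
  + move=> a o ra' oo; have [s2 k2] := okr _ ra'.
    have mg : moveF it cd o \in gens it cd.
      by rewrite /gens c0 inE; apply/orP; right; apply: map_f.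
    have ins2 : ev M [:: enctab a; encv (moveF it cd o).1;
        encC (moveF it cd o).2; unary k]
       insT (enctab (insF k a (moveF it cd o))).
      by apply: (@insT_ev M n.+2) => //; apply: (entry_okkey ft hP');
          apply: gen.
    eapply ev_call; [evs| |evs|evs|exact: ins2].
    by apply: ev_cons; [evs|eapply ev_call; [evs|evs|evs|evs|apply: vev;
        apply: o1]].
- by evs.
Qed.

Lemma stepT_ev M n K k T P it tab d : fits M n K k T -> size P < T ->
  okitem n it -> size it.1 <= M -> size tab <= M ->
  (forall cd, cd \in tab -> entry n K P cd) ->
  ev M [:: enctab tab; encit it; unary k; d] stepT (enctab (stepF k tab it)).
Proof.
move=> ft hP oit sit st ht.
apply: (ev_foldI (Inv := reach k n K (rcons P it)) (eX := enccd) (eA :=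
    enctab)) => //.
- exact: reach_nil.
- by move=> a cd ra /ht en; apply: reach_extF.
- move=> a cd ra /ht en; eapply ev_call; [evs|evs|evs|evs|].
  exact: extT_ev ft hP oit sit en ra.
Qed.

Lemma size_tabF k n K P : all (okitem n) P ->
  size (tabF k K (cols n [::]) P) <= tabsize n K.
Proof.
case/lastP: P => [_|P it]; first by rewrite /= expn_gt0.
rewrite all_rcons => /andP[oit oP].
rewrite /tabF foldl_rcons -/(tabF _ _ _ _).
have h cd : cd \in tabF k K (cols n [::]) P -> entry n K P cd.
  by case/(tabF_entry oP).
apply: (@reach_size k _ _ (rcons P it)); rewrite /stepF.
move: (tabF _ _ _ _) h => tab h; move: (reach_nil k n K (rcons P it)).
move: ([::] : seq cand); elim: tab h => //= cd l IH h a ra.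
apply: IH; first by move=> x xl; apply: h; rewrite inE xl orbT.
by apply: reach_extF => //; apply: h; rewrite mem_head.
Qed.

(** The zero vector of length [n.+1] and the numeral [n.+1] are the same tree, a list of [n.+1]
    leaves; the programs use the numeral as the vector. *)
Lemma encv_cols0 n : encv (cols n [::]) = unary n.+1.
Proof.
have -> : cols n [::] = nseq n.+1 0; last by rewrite unaryE /encv map_nseq.
apply: (@eq_from_nth _ 0) => [|i]; rewrite size_mkseq ?size_nseq // => hi.
by rewrite nth_mkseq // nth_nseq hi /col big_nil.
Qed.

Lemma tabT_ev M n K k T C : fits M n K k T -> size C <= T -> T <= M ->
  all (okitem n) C -> (forall it, it \in C -> size it.1 <= M) ->
  ev M [:: encC C; unary k; unary K; unary n.+1] tabT
    (enctab (tabF k K (cols n [::]) C)).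
Proof.
move=> ft hC hT oC sC.
apply: (ev_fold (eX := encit) (eA := enctab)) => [|||pre it post e].
- by evs.
- exact: leq_trans hC hT.
- apply: (@ev_eq _ _ _ (Node (Node (Node (unary K) (unary n.+1)) Leaf) Leaf)).
    by evs.
  by rewrite -encv_cols0.
have [oP oit] : all (okitem n) pre /\ okitem n it.
  by move: oC; rewrite e all_cat /= => /and3P[].
rewrite -/(tabF k K (cols n [::]) pre).
eapply ev_call; [evs|evs|evs|evs|].
refine (@stepT_ev M n K k T pre it _ _ ft _ oit _ _ _).
- by apply: leq_trans hC; rewrite e size_cat /=; lia.
- by apply: sC; rewrite e mem_cat mem_head orbT.
- by case: ft => _ _ _ _; apply: leq_trans; apply: size_tabF.
- by move=> cd /(tabF_entry oP)[].
Qed.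

Lemma bestT_ev M m C tab c d : size tab <= M ->
  (forall e, e \in tab -> okkey M m e.1) ->
  ev M [:: encC C; enctab tab; c; d] bestT (enccd (bestF C tab)).
Proof.
move=> hs hk; apply: (ev_foldI (Inv := fun=> True) (eX := enccd) (eA := enccd))
    => //.
move=> a e _ /hk /andP[_ ak]; rewrite (fun_if enccd).
apply: ev_ite => [|||_]; try by evs.
- evs; case: (e.1) ak => [|x [|y v]] //=; by case/and3P.
- by rewrite truthy_bool.
Qed.

Lemma roundT_ev M n K k T C : fits M n K k T -> size C <= T -> T <= M ->
  all (okitem n) C -> (forall it, it \in C -> size it.1 <= M) ->
  ev M [:: encC C; unary k; unary K; unary n.+1] roundT
    (encC (roundF k K (cols n [::]) C)).
Proof.
move=> ft hC hT oC sC; eapply ev_tl.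
  eapply ev_call; [evs| |evs|evs|].
    by eapply ev_call; [evs|evs|evs|evs|exact: tabT_ev ft hC hT oC sC].
  apply: (@bestT_ev _ n.+2).
    by case: ft => _ _ _ _; apply: leq_trans; apply: size_tabF.
  by move=> e /(tabF_entry oC)[en _]; apply: entry_okkey ft hC en.
by [].
Qed.

(** * Snapshots and their dominated vertices *)

Definition nbhs (V : finType) (G : sgraph V) (S : {set V}) : {set V} :=
  \bigcup_(u in S) closed_nbh G u.

Lemma nbhsE (V : finType) (G : sgraph V) (S : {set V}) v :
  (v \in nbhs G S) = [exists u in S, v \in closed_nbh G u].
Proof.
apply/bigcupP/existsP => [[u uS h]|[u /andP[uS h]]]; exists u => //.
by rewrite uS.
Qed.

Lemma activeE (V : finType) T (k : nat) (L : {set activity_interval V T}) v i :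
  is_timeline k 0 L ->
  active L v i = [exists I in L, (ivertex I == v) && (istart I == i)].
Proof.
move=> [_ hl]; apply: eq_existsb => I; case: (boolP (I \in L)) => //= IL.
have := hl I IL; rewrite /ilength leqn0 subn_eq0 => h1.
have h2 := itripleP I; congr (_ && _).
have e : istart I = iend I :> nat by apply/eqP; rewrite eqn_leq h2 h1.
by rewrite -e -eqn_leq -val_eqE.
Qed.

Lemma card_dominated (V : finType) T (G : temporal_graph V T)
    (L : {set activity_interval V T}) :
  #|dominated G L| = \sum_(i < T) #|nbhs (G i) [set v | active L v i]|.
Proof.
rewrite -sum1_card (reindex (fun p : 'I_T * V => (p.2, p.1))) /=; last first.
  by exists (fun p => (p.2, p.1)) => -[].
under [RHS]eq_bigr do rewrite -sum1_card.
rewrite pair_big_dep /=; apply: eq_bigl => -[i v].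
rewrite inE nbhsE; apply: eq_existsb => u; by rewrite inE.
Qed.

Definition instant (V : finType) T (v : V) (i : 'I_T) : activity_interval V T :=
  @ActivityInterval V T (v, i, i) (leqnn i).

Lemma sum_bool_card (I : finType) (P : pred I) :
  \sum_i (P i : nat) = #|[set i | P i]|.
Proof. by rewrite -sum1dep_card [RHS]big_mkcond; apply: eq_bigr => i _;
    case: (P i). Qed.

(** Intervals of length 0 are single times. Distinct active times of a vertex are the starts of
    distinct intervals, which gives the bound [k] from left to right; conversely, the instants given
    by [A] form a timeline. *)
Lemma timeline0P (V : finType) T (G : temporal_graph V T) (k t : nat) :
  (exists L : {set activity_interval V T},
     is_timeline k 0 L /\ t <= #|dominated G L|) <->
  (exists A : 'I_T -> {set V}, (forall v, \sum_(i < T) (v \in A i) <= k) /\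
     t <= \sum_(i < T) #|nbhs (G i) (A i)|).
Proof.
split=> [[L [tl ht]]|[A [hA ht]]].
  exists (fun i => [set v | active L v i]); split;
      last by rewrite -card_dominated.
  move=> v; apply: leq_trans (tl.1 v).
  rewrite sum_bool_card.
  apply: leq_trans (leq_imset_card (@istart V T) _); apply: subset_leq_card.
  apply/subsetP => i; rewrite !inE (activeE _ _ tl).
  case/existsP=> I /and3P[IL iv /eqP <-]; apply: imset_f.
  by rewrite inE IL.
pose L := [set I | (I == instant (ivertex I) (istart I)) &&
                   (ivertex I \in A (istart I))].
have tl : is_timeline k 0 L.
  split=> [v|I]; last by rewrite inE => /andP[/eqP -> _];
      rewrite /ilength subnn.
  apply: leq_trans (hA v); rewrite sum_bool_card.
  have sub : [set I in L | ivertex I == v] \subset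
      [set instant v i | i in [set i | v \in A i]].
    apply/subsetP => I; rewrite !inE => /andP[/andP[/eqP e h] /eqP iv].
    by rewrite e iv; apply: imset_f; rewrite inE -iv.
  exact: leq_trans (subset_leq_card sub) (leq_imset_card _ _).
exists L; split=> //; rewrite card_dominated; apply: leq_trans ht _.
apply: leq_sum => i _; apply: subset_leq_card; apply/subsetP => v.
rewrite !nbhsE => /existsP[u /andP[uA h]]; apply/existsP; exists u.
rewrite h andbT inE (activeE _ _ tl); apply/existsP; exists (instant u i).
by rewrite !inE /= !eqxx uA.
Qed.

(** * The options of a snapshot *)

Definition subsF (n : nat) : seq (seq nat) :=
  iter n (foldl (fun a x => [:: 0 :: x, 1 :: x & a]) [::]) [:: [::]].

Lemma mem_subsF n v : (v \in subsF n) = (size v == n) && all (leq^~ 1) v.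
Proof.
elim: n v => [|n IH] v; first by case: v.
have E w s a : (w \in foldl (fun a x => [:: 0 :: x, 1 :: x & a]) a s) =
    (w \in a) || ((0 < size w) && (head 0 w <= 1) && (behead w \in s)).
  elim: s a => [|x s IHs] a /=; first by rewrite andbF orbF.
  rewrite {}IHs !inE; case: w => [|[|[|y]] w] //=.
  - by rewrite !eqseq_cons /= orbCA !orbA.
  - by rewrite !eqseq_cons /= orbCA !orbA.
rewrite /subsF iterS E -/(subsF n) /= IH.
by case: v => //= x v; rewrite eqSS andbCA.
Qed.

Lemma size_subsF n : size (subsF n) = 2 ^ n.
Proof.
elim: n => // n IH; rewrite /subsF iterS -/(subsF n).
have E s a : size (foldl (fun a x => [:: 0 :: x, 1 :: x & a]) a s) =
    2 * size s + size a :> nat.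
  by elim: s a => //= x s IHs a; rewrite IHs /=; lia.
by rewrite E IH expnS addn0.
Qed.

(** The adjacency rows of the chosen vertices are added to the indicator vector itself, so an entry
    is positive exactly on the closed neighbourhood. *)
Definition domF (A : seq nat) (G : seq (seq nat)) : seq nat :=
  foldl (fun acc (p : nat * seq nat) => if 0 < p.1 then vadd p.2 acc else acc)
    A (zip A G).

Definition cntF (v : seq nat) : nat :=
  foldl (fun acc x => if 0 < x then acc.+1 else acc) 0 v.

Definition optsF (subs : seq (seq nat)) (G : seq (seq nat)) : seq (seq nat) :=
  foldl (fun acc A => (cntF (domF A G) :: A) :: acc) [::] subs.

Definition itemsF (Gs : seq (seq (seq nat))) subs (z : seq nat) : seq item :=
  foldl (fun acc G => (optsF subs G, z) :: acc) [::] Gs.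

Definition rows (V : finType) (G : sgraph V) : seq (seq nat) :=
  [seq [seq nat_of_bool (G u v) | v <- enum V] | u <- enum V].

Definition bits (V : finType) (S : {set V}) : seq nat :=
  [seq nat_of_bool (v \in S) | v <- enum V].

Definition setof (V : finType) (a : seq nat) : {set V} :=
  [set v | 0 < nth 0 a (index v (enum V))].

Lemma setofK (V : finType) a : size a = #|V| -> all (leq^~ 1) a ->
  bits (setof V a) = a.
Proof.
move=> sz /allP ha; have se : size (enum V) = #|V| by rewrite -cardE.
apply: (@eq_from_nth _ 0); rewrite size_map se // => i hi.
have v0 : V by case: (enum V) se hi => [<-|v *].
rewrite (nth_map v0) ?se // inE index_uniq ?enum_uniq ?se //.
by have := ha (nth 0 a i); rewrite mem_nth ?sz // => /(_ isT);
    case: (nth 0 a i) => [|[]].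
Qed.

Lemma bits_subsF (V : finType) (S : {set V}) : bits S \in subsF #|V|.
Proof.
rewrite mem_subsF size_map -cardE eqxx /=.
by apply/allP => _ /mapP[v _ ->]; apply: leq_b1.
Qed.

Lemma cntFE v : cntF v = count (ltn 0) v.
Proof.
have E a : foldl (fun acc x => if 0 < x then acc.+1 else acc) a v = a + count
    (ltn 0) v.
  by elim: v a => [|x v IH] a /=; rewrite ?addn0 // IH; case: ifP; lia.
exact: E.
Qed.

Lemma vadd_map (X : Type) (f g : X -> nat) s :
  vadd (map f s) (map g s) = [seq f x + g x | x <- s].
Proof. by elim: s => //= x s <-. Qed.

Lemma cnt_domF (V : finType) (G : sgraph V) (S : {set V}) :
  cntF (domF (bits S) (rows G)) = #|nbhs G S|.
Proof.
(* The entry at [v] after the rows of [us] have been processed. *)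
pose f (us : seq V) v := (v \in S) + \sum_(u <- us | u \in S) G u v.
have -> : domF (bits S) (rows G) = [seq f (enum V) v | v <- enum V].
  rewrite /domF /rows /bits.
  have -> : zip [seq nat_of_bool (v \in S) | v <- enum V]
      [seq [seq nat_of_bool (G u v) | v <- enum V] | u <- enum V] =
    [seq (nat_of_bool (u \in S), [seq nat_of_bool (G u v) | v <- enum V]) | u
        <- enum V].
    by elim: {1 3 5}(enum V) => //= u us ->.
  have E us : foldl (fun acc (p : nat * seq nat) =>
      if 0 < p.1 then vadd p.2 acc else acc)
      [seq nat_of_bool (v \in S) | v <- enum V]
      [seq (nat_of_bool (u \in S), [seq nat_of_bool (G u v) | v <- enum V]) | u
          <- us] =
      [seq f us v | v <- enum V].
    elim/last_ind: us => [|us u IH].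
      by apply: eq_map => v; rewrite /f big_nil addn0.
    rewrite map_rcons foldl_rcons IH /= /f; case: (boolP (u \in S)) => uS /=.
      rewrite vadd_map; apply: eq_map => v.
      by rewrite -cats1 big_cat /= big_cons big_nil uS; lia.
    by apply: eq_map => v; rewrite -cats1 big_cat /= big_cons big_nil (negbTE
        uS) addn0.
  exact: E.
rewrite cntFE count_map -sum1_count big_enum_cond sum1_card.
apply: eq_card => v; rewrite nbhsE [LHS]unfold_in -[LHS]/(0 < f (enum V) v) /f.
apply/idP/existsP => [h|[u /andP[uS]]]; last first.
  rewrite inE => /orP[/eqP ->|Guv]; first by rewrite uS.
  by rewrite big_enum_cond (bigD1 u) //= Guv; lia.
case: (boolP (v \in S)) h => [vS _|vS].
  by exists v; rewrite vS inE eqxx.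
rewrite add0n big_enum_cond lt0n sum_nat_eq0 negb_forall => /existsP[u].
by rewrite negb_imply => /andP[/andP[_ uS]]; rewrite eqb0 negbK => Guv;
    exists u; rewrite uS inE Guv orbT.
Qed.

Lemma optsFE subs G : optsF subs G = rev [seq cntF (domF A G) :: A | A <- subs].
Proof. by rewrite /optsF foldl_consE cats0. Qed.

Lemma itemsFE Gs subs z : itemsF Gs subs z = rev [seq (optsF subs G, z) | G <-
    Gs].
Proof. by rewrite /itemsF foldl_consE cats0. Qed.

Definition optv (V : finType) (G : sgraph V) (S : {set V}) : seq nat :=
  #|nbhs G S| :: bits S.

Lemma optsP (V : finType) (G : sgraph V) o :
  reflect (exists S : {set V}, o = optv G S) (o \in optsF (subsF #|V|) (rows
      G)).
Proof.
rewrite optsFE mem_rev; apply: (iffP mapP) => [[A + ->]|[S ->]].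
  rewrite mem_subsF => /andP[/eqP sz ha]; exists (setof V A).
  by rewrite /optv -cnt_domF setofK.
by exists (bits S); rewrite ?bits_subsF // cnt_domF.
Qed.

Lemma okopt_optv (V : finType) (G : sgraph V) S : okopt #|V| (optv G S).
Proof.
rewrite /okopt /= size_map -cardE eqxx /=.
rewrite (leq_trans (max_card _)) //=.
by have := bits_subsF S; rewrite mem_subsF => /andP[].
Qed.

Lemma okitem_optv (V : finType) (G : sgraph V) S :
  okitem #|V| (optsF (subsF #|V|) (rows G), optv G S).
Proof.
rewrite /okitem /= okopt_optv /=; apply/andP; split; last by apply/optsP;
    exists S.
by apply/allP => o /optsP[S' ->]; apply: okopt_optv.
Qed.

(** The search starts with no active vertices; in every snapshot this is the zero vector. *)
Lemma optv0 (V : finType) (G : sgraph V) : optv G set0 = cols #|V| [::].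
Proof.
have sc : size (cols #|V| [::]) = #|V|.+1 by rewrite size_mkseq.
apply: (@eq_from_nth _ 0) => [|j]; first by rewrite sc /= size_map -cardE.
rewrite /= size_map -cardE => hj; rewrite nth_mkseq // /col big_nil.
case: j hj => [|j] hj /=; first by rewrite /nbhs big_set0 cards0.
have v0 : V by have /card_gt0P/sigW[] : 0 < #|V| by apply: leq_ltn_trans (leq0n
    j) hj.
by rewrite (nth_map v0) ?inE // -cardE.
Qed.


Definition tpds_opts (V : finType) T (G : temporal_graph V T) :=
  [seq optsF (subsF #|V|) (rows (G i)) | i <- enum 'I_T].

Lemma col_optv (V : finType) T (G : temporal_graph V T) (A : 'I_T -> {set V}) D
    :
  D = [seq (optsF (subsF #|V|) (rows (G i)), optv (G i) (A i)) | i <- enum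
      'I_T] ->
  col 0 D = \sum_(i < T) #|nbhs (G i) (A i)| /\
  (forall k, feas k #|V| D <-> forall v, \sum_(i < T) (v \in A i) <= k).
Proof.
move=> ->; split; first by rewrite /col big_map big_enum.
have se : size (enum V) = #|V| by rewrite -cardE.
have colE (v0 : V) j : j < #|V| ->
  col j.+1 [seq (optsF (subsF #|V|) (rows (G i)), optv (G i) (A i)) | i <- enum
      'I_T] =
  \sum_(i < T) (nth v0 (enum V) j \in A i).
  move=> hj; rewrite /col big_map big_enum; apply: eq_bigr => i _.
  by rewrite /= (nth_map v0) ?se.
move=> k; split=> [/feasP h v|h].
  have hv : index v (enum V) < #|V| by rewrite -se index_mem mem_enum.
  by have := h (index v (enum V)).+1 hv; rewrite (colE v) // nth_index
      ?mem_enum.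
apply/feasP => -[//|j] hj.
have v0 : V by have /card_gt0P/sigW[] : 0 < #|V| by apply: leq_ltn_trans (leq0n
    j) hj.
by rewrite (colE v0).
Qed.

(** The options of a snapshot are exactly the vectors [optv] of its vertex sets. Hence the indicator
    part of an option, read back by [setof], determines the set, and the profit in it is the true
    one. *)
Lemma choice_items (V : finType) T (G : temporal_graph V T) (k t : nat) :
  (exists A : 'I_T -> {set V}, (forall v, \sum_(i < T) (v \in A i) <= k) /\
     t <= \sum_(i < T) #|nbhs (G i) (A i)|) <->
  (exists D, [/\ all (okitem #|V|) D, map fst D = tpds_opts G,
     feas k #|V| D & t <= col 0 D]).
Proof.
split=> [[A [hA ht]]|[D [oD mD fD ht]]].
  have [h1 h2] := @col_optv V T G A _ erefl.
  exists [seq (optsF (subsF #|V|) (rows (G i)), optv (G i) (A i)) | i <- enum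
      'I_T].
  split.
  - by apply/allP => _ /mapP[i _ ->]; apply: okitem_optv.
  - by rewrite -map_comp.
  - exact/h2.
  - by rewrite h1.
pose it0 : item := ([::], [::]).
have szD : size D = T by rewrite -(size_map fst) mD size_map size_enum_ord.
pose A (i : 'I_T) := setof V (behead (nth it0 D i).2).
exists A; have [|h1 h2] := @col_optv V T G A D; last by rewrite -h1 -h2.
apply: (@eq_from_nth _ it0); first by rewrite size_map size_enum_ord.
move=> j; rewrite szD => hj; pose i := Ordinal hj.
have ei : nth i (enum 'I_T) j = i by apply: val_inj; rewrite /= nth_enum_ord.
rewrite (nth_map i) ?size_enum_ord // ei.
have e1 : (nth it0 D j).1 = optsF (subsF #|V|) (rows (G i)).
  by rewrite -(nth_map it0 [::]) ?szD // mD (nth_map i) ?size_enum_ord // ei.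
have /and3P[o1 _ o2] : okitem #|V| (nth it0 D j) by apply: (allP oD);
    rewrite mem_nth ?szD.
rewrite e1 in o2; have [S eS] := optsP _ _ o2.
have eA : bits (A i) = bits S.
  have := bits_subsF S; rewrite mem_subsF => /andP[/eqP sz ab].
  by rewrite /A /= eS /= setofK.
rewrite [LHS]surjective_pairing e1 eS; congr (_, _).
by rewrite /optv -!cnt_domF eA.
Qed.

(** * The decision procedure *)

Definition encO (l : seq (seq nat)) : tree := enc_seq (map encv l).

Definition subsT := TFold (TVar 0) (TCons TNil TNil)
  (TFold (TVar 1) TNil (TCons (TCons TNil (TVar 0))
     (TCons (TCons tTrue (TVar 0)) (TVar 1)))).

Lemma subsT_ev M n b c d : n <= M -> 2 ^ n <= M ->
  ev M [:: unary n; b; c; d] subsT (encO (subsF n)).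
Proof.
move=> hn h2; apply: (ev_fold_unary (eA := encO)) => // j jn.
rewrite iterS -/(subsF j).
apply: (ev_foldI (Inv := fun=> True) (eX := encv) (eA := encO)) => //.
by rewrite size_subsF (leq_trans _ h2) // leq_exp2l // ltnW.
Qed.

Definition domT := TFold (TCall2 zipT (TVar 0) (TVar 1)) (TVar 0)
  (TIte (THd (TVar 0)) (TCall2 vaddT (TTl (TVar 0)) (TVar 1)) (TVar 1)).

Lemma domT_ev M n A G c d : n <= M -> size A = n -> size G = n ->
  (forall r, r \in G -> size r = n /\ all (leq^~ M) r) ->
  ev M [:: encv A; encO G; c; d] domT (encv (domF A G)) /\ size (domF A G) = n.
Proof.
move=> hM sA sG hG.
have sv r acc : r \in G -> size acc = n -> size (vadd r acc) = n.
  by move=> /hG[sr _] sa; rewrite size_map size_zip sr sa minnn.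
split; last first.
  rewrite /domF; have : forall p, p \in zip A G -> p.2 \in G.
    by move=> p /mem_zip[].
  elim: (zip A G) {1 3}A sA => //= p l IH a sa h; apply: IH.
    by case: ifP => // _; apply: sv => //; apply: h; rewrite mem_head.
  by move=> q ql; apply: h; rewrite inE ql orbT.
apply: (ev_foldI (Inv := fun a => size a = n) (eX := encpair unary encv) (eA :=
    encv)).
- by eapply ev_call; [evs|evs|evs|evs|apply: zipT_map; rewrite sA].
- by rewrite size_zip sA sG minnn.
- by evs.
- by [].
- by move=> a p sa /mem_zip[_ hp]; case: ifP => // _; apply: sv.
move=> a p sa /mem_zip[_ hp]; have [sr ar] := hG _ hp.
rewrite (fun_if encv); apply: ev_ite => [|||_]; try by evs.
  by rewrite truthy_unary.
move=> _; eapply ev_call; [evs|evs|evs|evs|].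
by apply: vaddT_ev => //; rewrite sr.
Qed.

Definition cntT := TFold (TVar 0) TNil (TIte (TVar 0) (TCons TNil (TVar 1))
    (TVar 1)).

Lemma cntT_ev M v b c d : size v <= M ->
  ev M [:: encv v; b; c; d] cntT (unary (cntF v)).
Proof.
move=> hv; apply: (ev_foldI (Inv := fun=> True) (eX := unary) (eA := unary)) =>
    //.
move=> a x _ _; rewrite (fun_if unary); apply: ev_ite => [|||_]; try by evs.
by rewrite truthy_unary.
Qed.

Definition optsT := TFold (TVar 0) TNil
  (TCons (TCons (TCall1 cntT (TCall2 domT (TVar 0) (TVar 3))) (TVar 0)) (TVar
      1)).

Lemma optsT_ev M n subs G c d : n <= M -> size subs <= M -> size G = n ->
  (forall A, A \in subs -> size A = n) ->
  (forall r, r \in G -> size r = n /\ all (leq^~ M) r) ->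
  ev M [:: encO subs; encO G; c; d] optsT (encO (optsF subs G)).
Proof.
move=> hn hs sG hsub hG.
apply: (ev_foldI (Inv := fun=> True) (eX := encv) (eA := encO)) => //.
move=> a A _ /hsub sA; have dm c' d' := @domT_ev M n A G c' d' hn sA sG hG.
eapply ev_cons; last by evs.
eapply ev_cons; last by evs.
eapply ev_call; [|evs|evs|evs|].
  by eapply ev_call; [evs|evs|evs|evs|exact: (dm _ _).1].
by apply: cntT_ev; rewrite (dm Leaf Leaf).2.
Qed.

Definition itemsT := TFold (TVar 0) TNil
  (TCons (TCons (TCall2 optsT (TVar 3) (TVar 0)) (TVar 4)) (TVar 1)).

Lemma itemsT_ev M n Gs subs z d : n <= M -> size subs <= M -> size Gs <= M ->
  (forall A, A \in subs -> size A = n) ->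
  (forall G, G \in Gs -> size G = n /\
     forall r, r \in G -> size r = n /\ all (leq^~ M) r) ->
  ev M [:: enc_seq (map encO Gs); encO subs; encv z; d] itemsT
    (encC (itemsF Gs subs z)).
Proof.
move=> hn hs sG hsub hG.
apply: (ev_foldI (Inv := fun=> True) (eX := encO) (eA := encC)) => //.
move=> a G _ /hG[sz hr]; eapply ev_cons; last by evs.
eapply ev_cons; last by evs.
by eapply ev_call; [evs|evs|evs|evs|apply: (@optsT_ev M n)].
Qed.

(** Horner's rule from the most significant bit, cut at the cap after every bit, since the uncut
    value can be exponential in the number of bits. Early cuts do not change the result: once the
    cap is reached, doubling cannot fall below it. *)
Definition hornT := TFold (TCall1 revT (TVar 0)) TNil
  (TCall2 minT (TCall2 addT (TVar 0) (TCall2 addT (TVar 1) (TVar 1))) (TVar 3)).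

Lemma horner_bits m l : m < 2 ^ l ->
  foldr (fun (b : bool) acc => b + (acc + acc)) 0
    (mkseq (fun i => odd (m %/ 2 ^ i)) l) = m.
Proof.
elim: l m => [|l IH] m hm; first by move: hm; rewrite expn0; case: m.
rewrite /mkseq /= (iotaDl 1 0) -map_comp expn0 divn1.
have -> : [seq ((fun i => odd (m %/ 2 ^ i)) \o addn 1) i | i <- iota 0 l] =
    mkseq (fun i => odd (m./2 %/ 2 ^ i)) l.
  by apply: eq_map => i /=; rewrite add1n expnS divnMA divn2.
rewrite IH; first by rewrite addnn odd_double_half.
by rewrite -divn2 ltn_divLR // -expnSr.
Qed.

Lemma hornT_ev M m cap c d : up_log 2 m.+1 <= M -> (2 * cap).+1 <= M ->
  ev M [:: enc_nat m; unary cap; c; d] hornT (unary (minn m cap)).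
Proof.
move=> hl hc; rewrite /enc_nat; set bs := mkseq _ _.
pose bb := mkseq (fun i => odd (m %/ 2 ^ i)) (up_log 2 m.+1).
have -> : bs = map enc_bool bb by rewrite /bs /bb /mkseq -map_comp.
have -> : minn m cap = foldl (fun acc (b : bool) =>
    minn (b + (acc + acc)) cap) 0 (rev bb).
  rewrite foldl_rev -{1}(@horner_bits m (up_log 2 m.+1)) -/bb; last first.
    by rewrite up_logP.
  by elim: bb => [|b s IH] /=; [rewrite min0n|rewrite -IH; lia].
apply: (ev_foldI (Inv := fun a => a <= cap) (eX := enc_bool) (eA := unary)).
- rewrite map_rev; eapply ev_call; [evs|evs|evs|evs|].
  by apply: revT_ev; rewrite size_map size_mkseq.
- by rewrite size_rev size_mkseq.
- by evs.
- by [].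
- by move=> a b _ _; rewrite geq_minr.
- move=> a b ha _; rewrite -unary_bool; evs; case: b => /=; lia.
Qed.

Definition gT := TFold (TVar 0) tTrue
  (TCall2 mulT (TVar 1) (TCons TNil (TCall2 addT (TVar 1) (TVar 1)))).

Lemma gT_ev M n b c d : n <= M -> gbound n <= M ->
  ev M [:: unary n; b; c; d] gT (unary (gbound n)).
Proof.
move=> hn hg; have E j : gbound j = iter j (fun x => x * (2 * x).+1) 1.
  by elim: j => //= j <-.
rewrite E; apply: (ev_fold_unary (eA := unary)) => // j jn.
rewrite -!E.
have h1 : gbound j.+1 <= M := leq_trans (leq_gbound jn) hg.
have h0 := gbound_gt0 j.
have h2 : (2 * gbound j).+1 <= gbound j.+1 by rewrite /= leq_pmull.
have h3 : gbound j <= M by lia.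
eapply ev_call; [evs| |evs|evs|].
  apply: (@ev_eq _ _ _ (unary (gbound j + gbound j).+1)); last by [].
  by evs.
have -> : gbound j.+1 = gbound j * (gbound j + gbound j).+1.
  by rewrite [LHS]/= mul2n addnn.
by apply: mulT_unary => //; lia.
Qed.

Definition valT := TFold (TVar 0) TNil (TCall2 addT (THd (TTl (TVar 0))) (TVar
    1)).

Lemma valT_ev M n C b c d : size C <= M -> n.+1 <= M -> all (okitem n) C ->
  ev M [:: encC C; b; c; d] valT (unary (col 0 C)).
Proof.
move=> hC hn /allP oC.
have -> : col 0 C = foldl (fun a (it : item) => head 0 it.2 + a) 0 C.
  have E s a : a + col 0 s = foldl (fun a (it : item) => head 0 it.2 + a) a s.
    elim: s a => [|it s IH] a /=; first by rewrite /col big_nil addn0.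
    by rewrite -IH col_cons nth0; lia.
  by rewrite -E add0n.
apply: (ev_foldI (Inv := fun=> True) (eX := encit) (eA := unary)) => //.
move=> a it _ /oC/and3P[/and3P[_ ho _] _ _]; evs.
by apply: leq_trans ho hn.
Qed.

(** Inside all the lets, the environment from index 0 is: final choice, initial items, zero vector,
    [gbound n], [k] cut at the cap, the cap, [n], the input. *)
Definition mainT :=
  TLet (THd (THd (TVar 0)))
  (TLet (TCall2 mulT (TCons TNil (TVar 0)) (TCons TNil (TTl (THd (TVar 1)))))
  (TLet (TCall2 hornT (THd (TTl (TVar 2))) (TVar 0))
  (TLet (TCall1 gT (TVar 2))
  (TLet (TCons TNil (TVar 3))
  (TLet (TCall itemsT (TTl (THd (TVar 5))) (TCall1 subsT (TVar 4)) (TVar 0)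
      TNil)
  (TLet (TFold (TVar 4) (TVar 0)
          (TCall roundT (TVar 1) (TVar 5) (TVar 4) (TVar 3)))
  (TCall2 leqT (TCall2 hornT (TTl (TTl (TTl (TVar 7)))) (TVar 5))
     (TCall1 valT (TVar 0))))))))).

(** Strictly above all profits and usages, which [col_le] bounds by [n.+1 * T]. Cutting [k] and [t]
    here therefore changes no answer, and this many rounds reach an optimum. *)
Definition tpds_cap (x : tpds_instance) : nat := #|tpds_V x|.+1 * (tpds_T x).+1.

Definition tpds_items (x : tpds_instance) : seq item :=
  itemsF [seq rows (tpds_G i) | i <- enum 'I_(tpds_T x)] (subsF #|tpds_V x|)
    (cols #|tpds_V x| [::]).

Definition tpds_final (x : tpds_instance) : seq item :=
  let n := #|tpds_V x| in
  iter (tpds_cap x) (roundF (minn (tpds_k x) (tpds_cap x)) (gbound n) (cols n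
      [::]))
    (tpds_items x).

Lemma tpds_itemsE x : tpds_items x =
  rev [seq (o, cols #|tpds_V x| [::]) | o <- tpds_opts (@tpds_G x)].
Proof. by rewrite /tpds_items itemsFE -!map_comp. Qed.

Lemma fst_tpds_items x : map fst (tpds_items x) = rev (tpds_opts (@tpds_G x)).
Proof. by rewrite tpds_itemsE map_rev -map_comp map_id. Qed.

Lemma ok_tpds_items x : all (okitem #|tpds_V x|) (tpds_items x).
Proof.
rewrite tpds_itemsE all_rev; apply/allP => _ /mapP[_ /mapP[i _ ->] ->].
by rewrite -(optv0 (tpds_G i)); apply: okitem_optv.
Qed.

Lemma feas_tpds_items k x : feas k #|tpds_V x| (tpds_items x).
Proof.
apply/feasP => j /andP[_ jn]; rewrite tpds_itemsE col_rev /col big_map big1 //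
    => o _.
by rewrite nth_mkseq ?ltnS // /col big_nil.
Qed.

Lemma mainT_correct x : tpds_l x = 0 ->
  (minn (tpds_t x) (tpds_cap x) <= col 0 (tpds_final x)) <-> tpds_yes x.
Proof.
move=> l0; rewrite /tpds_yes l0.
apply: iff_trans (iff_sym (timeline0P _ _ _)).
apply: iff_trans (iff_sym (choice_items _ _ _)).
set k := minn (tpds_k x) (tpds_cap x); set n := #|tpds_V x|.
have colT D j : all (okitem n) D -> map fst D = tpds_opts (@tpds_G x) ->
    col j D < tpds_cap x.
  move=> oD mD; apply: leq_ltn_trans (col_le j oD) _.
  have -> : size D = tpds_T x by rewrite -(size_map fst) mD size_map
      size_enum_ord.
  by rewrite /tpds_cap -/n ltn_mul2l /=.
have feask D : all (okitem n) D -> map fst D = tpds_opts (@tpds_G x) ->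
    feas (tpds_k x) n D = feas k n D.
  move=> oD mD; apply/feasP/feasP => h j hj.
    by rewrite leq_min h // ltnW // colT.
  by have := h j hj; rewrite leq_min => /andP[].
have [oR fR mR opt] := @iter_roundF_optimal k n (tpds_items x) (tpds_cap x)
  (ok_tpds_items x) (feas_tpds_items k x).
rewrite -/(tpds_final x) in oR fR mR opt.
(* [R] is the final choice in the order of the times, which the rounds may have reversed. *)
have [R [oR' mR' fR' cR]] : exists R, [/\ all (okitem n) R,
    map fst R = tpds_opts (@tpds_G x), feas k n R & col 0 R = col 0 (tpds_final
        x)].
  rewrite fst_tpds_items revK in mR; case: mR => mR;
      last by exists (tpds_final x).
  exists (rev (tpds_final x)); rewrite all_rev map_rev mR revK col_rev;
      split=> //.
  by apply/feasP => j hj; rewrite col_rev; apply: (feasP _ _ _ fR).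
split=> [h|[D [oD mD fD tD]]].
  exists R; split=> //; first by rewrite feask.
  by have := colT R 0 oR' mR'; move: h; rewrite -cR; lia.
(* No profit reaches the number of rounds, so the final choice is optimal. *)
case: opt => [h|opt]; first by have := colT R 0 oR' mR'; rewrite cR; lia.
have : col 0 (rev D) <= col 0 (tpds_final x).
  apply: opt; rewrite ?all_rev // ?map_rev ?mD ?fst_tpds_items //.
  by rewrite feask // in fD; apply/feasP => j hj; rewrite col_rev;
      apply: (feasP _ _ _ fD).
by rewrite col_rev; lia.
Qed.

Lemma enc_sgraphE (V : finType) (G : sgraph V) : enc_sgraph G = encO (rows G).
Proof.
rewrite /enc_sgraph /encO /rows -[in RHS]map_comp; congr enc_seq.
apply: eq_map => u /=; rewrite /encv -[in RHS]map_comp; congr enc_seq.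
by apply: eq_map => v /=; rewrite unary_bool.
Qed.

Lemma mainT_ev M (x : tpds_instance) : let n := #|tpds_V x| in
  n.+2 <= M -> gbound n <= M -> tabsize n (gbound n) <= M -> 2 ^ n <= M ->
  (2 * tpds_cap x).+1 <= M -> up_log 2 (tpds_k x).+1 <= M ->
  up_log 2 (tpds_t x).+1 <= M ->
  ev M [:: enc_tpds x] mainT
    (enc_bool (minn (tpds_t x) (tpds_cap x) <= col 0 (tpds_final x))).
Proof.
move=> n hn hg ht h2 hc hk htt.
have capE : tpds_cap x = n.+1 * (tpds_T x).+1 by [].
have hT : (tpds_T x).+1 <= tpds_cap x by rewrite capE leq_pmull.
have hTM : tpds_T x <= M by lia.
set k := minn (tpds_k x) (tpds_cap x).
have ft : fits M n (gbound n) k (tpds_T x).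
  split=> //; first by rewrite /k; lia.
  by apply: leq_trans (_ : tpds_cap x <= _); [rewrite capE leq_mul2l leqnSn
      orbT|lia].
pose Gs := [seq rows (tpds_G i) | i <- enum 'I_(tpds_T x)].
have sGs : size Gs = tpds_T x by rewrite size_map size_enum_ord.
have eG : enc_temporal_graph (@tpds_G x) = Node (unary n) (enc_seq (map encO
    Gs)).
  congr Node; congr enc_seq; rewrite /Gs -map_comp; apply: eq_map => i.
  exact: enc_sgraphE.
rewrite /enc_tpds eG.
apply: (ev_let (v := unary n)); first by evs.
apply: (ev_let (v := unary (tpds_cap x))).
  eapply ev_call; [evs|evs|evs|evs|].
  have s2 : size (Leaf :: map encO Gs) = (tpds_T x).+1 by rewrite /= size_map
      sGs.
  have := @mulT_ev M (nseq n.+1 Leaf) (Leaf :: map encO Gs) Leaf Leaf.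
  by rewrite s2 size_nseq -unaryE -capE; apply; lia.
apply: (ev_let (v := unary k)).
  by eapply ev_call; [evs|evs|evs|evs|apply: hornT_ev].
apply: (ev_let (v := unary (gbound n))).
  by eapply ev_call; [evs|evs|evs|evs|apply: gT_ev => //; lia].
apply: (ev_let (v := unary n.+1)); first by evs.
apply: (ev_let (v := encC (tpds_items x))).
  eapply ev_call; [evs| |evs|evs|].
    by eapply ev_call; [evs|evs|evs|evs|apply: subsT_ev => //; lia].
  rewrite -encv_cols0; apply: (@itemsT_ev M n); rewrite ?size_subsF ?sGs //.
  - by lia.
  - by move=> A; rewrite mem_subsF => /andP[/eqP].
  - move=> _ /mapP[i _ ->]; rewrite size_map -cardE; split=> // r /mapP[u _ ->].
    rewrite size_map -cardE; split=> //; apply/allP => _ /mapP[v _ ->].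
    by apply: leq_trans (leq_b1 _) _; lia.
have inv j : let C := iter j (roundF k (gbound n) (cols n [::])) (tpds_items x)
    in
    [/\ all (okitem n) C, size C = tpds_T x & forall it, it \in C -> size it.1
        <= M].
  have [oC _ mC _] := @iter_roundF_optimal k n (tpds_items x) j
    (ok_tpds_items x) (feas_tpds_items k x).
  rewrite fst_tpds_items revK in mC; split=> //.
    by rewrite -(size_map fst); case: mC => ->;
        rewrite ?size_rev size_map size_enum_ord.
  move=> it itC; suff /mapP[i _ ->] : it.1 \in tpds_opts (@tpds_G x).
    by rewrite optsFE size_rev size_map size_subsF.
  by have := map_f fst itC; case: mC => ->; rewrite ?mem_rev.
apply: (ev_let (v := encC (tpds_final x))).
  apply: (ev_fold_unary (eA := encC)); [by evs|lia|by evs|move=> j _].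
  have [oC sC itC] := inv j; eapply ev_call; [evs|evs|evs|evs|].
  by apply: roundT_ev ft _ hTM oC itC; rewrite sC.
have [oC sC _] := inv (tpds_cap x).
eapply ev_call; [| |evs|evs|].
- by eapply ev_call; [evs|evs|evs|evs|apply: hornT_ev].
- eapply ev_call; [evs|evs|evs|evs|apply: (@valT_ev M n) oC].
    by rewrite sC.
  by lia.
apply: leqT_ev; apply: leq_trans (col_le 0 oC) _; rewrite sC.
by case: ft.
Qed.

(** * The time bound *)

Lemma run_tm M t x v : 8 <= M -> ev M [:: x] t v ->
  exists2 tau, runs (Seq (compile [:: 0] 1 t) (Assign 0 (EVar 1))) x tau v
    & tau <= M ^ deg t + 2.
Proof.
move=> hM [hv hs].
have [|s' [tau [he hd _ hb]]] :=
  @compile_correct M t [:: 0] 1 (update (fun=> Leaf) 0 x) hM isT.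
  by rewrite /= updateE.
exists (tau + 2); last by rewrite leq_add2r.
eexists; first by apply: (exec_seq he); apply: exec_assign.
by rewrite updateE /= hd /= updateE.
Qed.

Fixpoint powT (m : nat) : tm :=
  if m is m'.+1 then TCall2 mulT (TVar 0) (powT m') else tTrue.

Lemma powT_ev M w m env : w ^ m <= M -> 0 < w -> w <= M ->
  ev M (unary w :: env) (powT m) (unary (w ^ m)).
Proof.
move=> + w0 wM; elim: m => [|m IH] hm /=; first by evs.
have hm' : w ^ m <= M by apply: leq_trans hm; rewrite leq_pexp2l.
rewrite expnS; eapply ev_call; [evs|exact: IH|evs|evs|].
exact: mulT_unary.
Qed.

Definition boundT (m : nat) :=
  TLet (TCall1 gT (TVar 0))
  (TLet (TCall2 mulT (TCons TNil (TVar 1)) (TVar 0))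
  (TLet (TCons TNil (TCall2 addT (TVar 0) (TVar 0)))
  (TLet (TFold (TCons TNil (TCons TNil (TVar 3))) tTrue
           (TCall2 mulT (TVar 2) (TVar 1)))
  (powT m)))).

(** The parameter function of the time bound; [boundT m] is the term that computes it. *)
Definition fbound (m n : nat) : nat := tabsize n (gbound n) ^ m.

(** One number dominates every bound in terms of [n] that the safety of the program needs. Its base
    is at least 3 and its exponent at least 2, whence 9. *)
Lemma tabsize_ge n : 9 <= tabsize n (gbound n) /\ n.+2 <= tabsize n (gbound n)
  /\ 2 ^ n <= tabsize n (gbound n) /\ n.+1 * gbound n <= tabsize n (gbound n).
Proof.
have h0 := gbound_gt0 n; rewrite /tabsize; set b := (2 * _).+1.
have hb : 2 < b by have : 0 < n.+1 * gbound n; rewrite ?muln_gt0 // /b; lia.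
have h3 : 3 ^ n.+2 <= b ^ n.+2 by rewrite leq_exp2r.
have h1 : n.+2 < 3 ^ n.+2 by apply: ltn_expl.
split; first by apply: leq_trans h3; rewrite -[9]/(3 ^ 2) leq_exp2l.
split; first by lia.
split.
  apply: leq_trans h3; apply: leq_trans (_ : 3 ^ n <= _);
      first by case: n {b h0 hb h1} => // n; rewrite leq_exp2r.
  by rewrite leq_exp2l // ; lia.
apply: leq_trans (_ : b <= _); first by rewrite /b; lia.
by rewrite -{1}(expn1 b) leq_exp2l; lia.
Qed.

Lemma boundT_computable m : computable (fbound m.+1).
Proof.
exists (Seq (compile [:: 0] 1 (boundT m.+1)) (Assign 0 (EVar 1))) => n.
have [h9 [hn [_ hg]]] := tabsize_ge n; set w := tabsize n (gbound n) in h9 hn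
    hg.
pose M := w ^ m.+1.
have wM : w <= M by rewrite /M expnS leq_pmulr // expn_gt0; lia.
suff /(@run_tm _ _ _ _ (_ : 8 <= M))[|tau hr _] : ev M [:: unary n] (boundT
    m.+1) (unary (fbound m.+1 n)).
- by lia.
- by exists tau.
set g := gbound n in hg *.
have h0 : 0 < g := gbound_gt0 n.
have hgM : g <= M by nia.
apply: (ev_let (v := unary g)).
  by eapply ev_call; [evs|evs|evs|evs|apply: gT_ev => //; lia].
apply: (ev_let (v := unary (n.+1 * g))).
  eapply ev_call; [evs|evs|evs|evs|].
  by apply: (@mulT_unary M n.+1 g); lia.
apply: (ev_let (v := unary (2 * (n.+1 * g)).+1)).
  by rewrite mul2n -addnn; evs; lia.
set b := (2 * _).+1.
have E j : b ^ j = iter j (muln b) 1 by elim: j => //= j <-; rewrite expnS.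
have bj j : j <= n.+2 -> b ^ j <= M.
  by move=> hj; apply: leq_trans wM; rewrite /w /tabsize leq_pexp2l.
apply: (ev_let (v := unary w)).
  rewrite /w /tabsize -/g -/b E; apply: (ev_fold_unary (eA := unary)).
  - by evs.
  - by lia.
  - by evs.
  - move=> j hj; rewrite iterS -E; eapply ev_call; [evs|evs|evs|evs|].
    apply: mulT_unary; last by apply: bj; lia.
    by rewrite -(expn1 b); apply: bj.
by apply: powT_ev => //; lia.
Qed.

Lemma size_lt_tsize s : size s < Defs.tsize (enc_seq s).
Proof. by elim: s => //= x s IH; lia. Qed.

(** Vertices and snapshots are written out one by one, so both counts are below the input size [N]
    and the cap is at most [N ^ 2]; for [k] and [t] only the bit lengths are bounded. *)
Lemma tsize_enc_parts n s k l t :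
  let N := Defs.tsize (Node (Node (unary n) (enc_seq s))
             (Node (enc_nat k) (Node (enc_nat l) (enc_nat t)))) in
  [/\ n.+1 * (size s).+1 <= N ^ 2, up_log 2 k.+1 <= N & up_log 2 t.+1 <= N].
Proof.
have un : n < Defs.tsize (unary n).
  by rewrite unaryE -{1}(size_nseq n Leaf) size_lt_tsize.
have blen m : up_log 2 m.+1 < Defs.tsize (enc_nat m).
  have := size_lt_tsize (mkseq (fun i => enc_bool (odd (m %/ 2 ^ i))) (up_log 2
      m.+1)).
  by rewrite size_mkseq.
have gr := size_lt_tsize s; have nk := blen k; have nt := blen t.
rewrite [Defs.tsize _]/=; split; try by lia.
by rewrite -mulnn; apply: leq_mul; lia.
Qed.

Lemma tsize_enc_tpds x : let N := Defs.tsize (enc_tpds x) in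
  [/\ tpds_cap x <= N ^ 2, up_log 2 (tpds_k x).+1 <= N &
      up_log 2 (tpds_t x).+1 <= N].
Proof.
have := tsize_enc_parts #|tpds_V x|
  [seq enc_sgraph (tpds_G i) | i <- enum 'I_(tpds_T x)] (tpds_k x) (tpds_l x)
      (tpds_t x).
by rewrite size_map size_enum_ord.
Qed.

Theorem theorem5p4 :
  fpt (restrict (Q := timeline_partial_dominating_set)
        (fun x : tpds_instance => tpds_l x = 0)).
Proof.
(* The added factor [M] pays for the 2 units of the final copy to register 0. *)
pose D := (deg mainT).+1.
exists (Seq (compile [:: 0] 1 mainT) (Assign 0 (EVar 1))), (fbound D), (2 * D).
split; first exact: boundT_computable.
case=> x l0 /=; set n := #|tpds_V x|; set N := Defs.tsize (enc_tpds x).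
have [hcap hk ht] := tsize_enc_tpds x; rewrite -/N in hcap hk ht.
have [h9 [hn [h2 hg]]] := tabsize_ge n; have g0 := gbound_gt0 n.
have N0 : 0 < N by rewrite /N; case: (enc_tpds x).
(* [w] covers the quantities that depend on [n], and [N ^ 2] covers the cap; [w] being at least 9
   leaves room for constants, as in [(2 * tpds_cap x).+1]. *)
set w := tabsize n (gbound n) in h9 hn h2 hg; pose M := w * N ^ 2.
have NN : N <= N ^ 2 by rewrite -mulnn leq_pmulr.
have wM : w <= M by rewrite leq_pmulr // expn_gt0 N0.
have NM : 9 * N ^ 2 <= M by rewrite leq_mul2r h9 orbT.
have h := @mainT_ev M x.
have {h}/run_tm[|tau hr htau] : ev M [:: enc_tpds x] mainT
    (enc_bool (minn (tpds_t x) (tpds_cap x) <= col 0 (tpds_final x))).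
- by apply: h; rewrite -?/n; nia.
- by lia.
exists tau, (enc_bool (minn (tpds_t x) (tpds_cap x) <= col 0 (tpds_final x))).
split=> //; last by rewrite truthy_bool; apply: mainT_correct.
(* [w ^ D * N ^ (2 * D)] is [M ^ D], so the two factors of the bound recombine. *)
apply: leq_trans htau _; rewrite /fbound -/w expnM -expnMn -/M /D expnS.
have : 0 < M ^ deg mainT by rewrite expn_gt0; lia.
by move: (M ^ _) => X; nia.
Qed.
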